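(* Suppose $f_s$, $s\in[s_{min},s_{max}]$, is a monotone family of circle maps with flat spots, and $\tilde f_s$ is its lift to $\mathbb R$. Then: 1. The rotation number $\rho(s)=\lim_{n\to\infty}\frac{(\tilde f_s)^n(\tilde x)-\tilde x}{n}$ exists (that is, the limit exists and does not depend on the initial point $\tilde x\in\mathbb R$). Moreover, $\rho(s)$ is continuous and non-decreasing. 2. For any $\frac pq\in\mathbb Q$, its preimage $\rho^{-1}(p/q)$ is a closed interval with positive length (unless it is an empty set). For any $r\notin\mathbb Q$, its preimage $\rho^{-1}(r)$ is a point (unless it is an empty set). 3. The set $C=\{s\in[s_{min},s_{max}]:\rho(s)\notin\mathbb Q\}$ is a nowhere dense perfect set. 4. The Hausdorff dimension $\dim_H(C)=0$. 5. The function $\rho(s)$ is ''steep to all orders'' at the endpoints of each plateau $\rho^{-1}(p/q)$. More precisely, let $s_0$ be the right endpoint of a plateau and let $\Delta\rho=\rho(s_0+\Delta s)-\rho(s_0)$. Then there exist $c>0$ and $\delta>0$ such that $\Delta s<e^{-c/\Delta\rho}$ when $\Delta s\in(0,\delta)$. A similar statement holds for the left endpoint of every plateau (with $\Delta\rho=\rho(s_0)-\rho(s_0-\Delta s)$). This inequality implies that for any $n\in\mathbb N$ we have $(\Delta\rho)^n\gg\Delta s$ when $\Delta s\to0^+$; that is, the graph of $\rho(s)$ is tangent to all orders to the vertical lines passing through the plateau's endpoints.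
   Context: Monotone family of circle maps with flat spots: let $f_s:S^1\to S^1$, where $S^1=\mathbb R/\mathbb Z$, be a one-parameter family of circle maps defined for $s\in[s_{min},s_{max}]$ and continuous with respect to both $x$ and $s$. Let $\tilde f_s:\mathbb R\to\mathbb R$ be a lift of $f_s$. The family $f_s$ is called a monotone family if: (1) $\tilde f_s(x)$ is continuous and non-decreasing with respect to both $x$ and $s$. (2) $f_s$ has degree $1$ for all $s$. (3) There are $m$ flat spots for each $s$, where $m\ge1$ is an integer independent of $s$. More precisely, there exist $m\ge1$ and $m$ disjoint closed arcs $I_j(s)$ such that $f_s|_{I_j}$ is constant. The endpoints of these arcs depend on $s$ continuously. (4) There exists $\lambda>1$ such that for each $s$ the map $f_s$ is $\lambda$-expanding outside $\bigcup_{j=1}^m I_j$: $\tilde f_s(x)$ is differentiable in $x$ and $\frac{d}{dx}\tilde f_s(x)>\lambda$. (5) Pick any lifts $\tilde I_j$, $j=1,\dots,m$, of the flat spots and let $\tilde b_j(s)=\tilde f_s(\tilde I_j(s))$ be the ''height'' of the plateau above $\tilde I_j$. Then each of these heights is differentiable with respect to $s$ and increases with speed separated from zero: there exists $\nu>0$ such that $\frac{d}{ds}\tilde b_j(s)>\nu$ for all $s$ and $j=1,\dots,m$. A plateau of $\rho$ is a nonempty preimage $\rho^{-1}(p/q)$ of a rational number.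
   Formalization: Item 2: positive length is claimed except when the rational preimage is the single point s_min or s_max. Item 3: C itself is not closed, so the closure of C is shown perfect, C nowhere dense, and points of the closure outside C are plateau endpoints. *)

(* Defs.v *)
From HB Require Import structures.
From mathcomp Require Import all_boot all_order all_algebra.
From mathcomp Require Import generic_quotient.
From mathcomp Require Import all_classical all_reals all_analysis.

Set Implicit Arguments.
Unset Strict Implicit.
Unset Printing Implicit Defensive.

Import Order.TTheory GRing.Theory Num.Theory.
Import numFieldNormedType.Exports.

Local Open Scope quotient_scope.
Local Open Scope classical_set_scope.
Local Open Scope ring_scope.

Section Circle.
Variable R : realType.

Definition eqmodZ (x y : R) : bool := (x - y) \is a Num.int.

Lemma eqmodZ_refl : reflexive eqmodZ.
Proof. by move=> x; rewrite /eqmodZ subrr rpred0. Qed.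

Lemma eqmodZ_sym : symmetric eqmodZ.
Proof. by move=> x y; rewrite /eqmodZ -opprB rpredN. Qed.

Lemma eqmodZ_trans : transitive eqmodZ.
Proof.
move=> y x z xy yz.
by rewrite /eqmodZ -(subrK y x) -addrA rpredD.
Qed.

Canonical eqmodZ_equiv :=
  EquivRel eqmodZ eqmodZ_refl eqmodZ_sym eqmodZ_trans.

(* R/Z with the quotient topology. *)
Definition circle : Type := quotient_topology {eq_quot eqmodZ}.

HB.instance Definition _ := Topological.copy circle (quotient_topology {eq_quot eqmodZ}).

Definition circle_proj (x : R) : circle := \pi_({eq_quot eqmodZ}) x.

(* The closed arc swept counterclockwise from a to b. *)
Definition circle_arc (a b : R) : set circle := circle_proj @` `[a, b].

End Circle.

Section MonotoneFamily.
Variable R : realType.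
Implicit Types (smin smax : R) (f : R -> circle R -> circle R) (F : R -> R -> R).

(* l is the derivative of h at s along the set A; at an endpoint of an interval
   A this is the one-sided derivative. *)
Definition is_derive_within (A : set R) (h : R -> R) (s l : R) : Prop :=
  (h t - h s) / (t - s) @[t --> within A s^'] --> l.

(* f s is the circle map with parameter s and F s the chosen lift of it; only
   parameters in [smin, smax] are constrained. The j-th flat spot at parameter s
   is the nondegenerate arc that lifts to [a j s, b j s], so that its height is
   F s (a j s). *)
Record monotone_family smin smax f F (m : nat) (a b : 'I_m -> R -> R) : Prop :=
  MonotoneFamily {
    mf_params : smin < smax;
    mf_map_continuous : {within `[smin, smax] `*` [set: circle R],
      continuous (fun p : R * circle R => f p.1 p.2)};
    mf_lift : forall s, s \in `[smin, smax] -> forall x,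
      circle_proj (F s x) = f s (circle_proj x);
    mf_lift_continuous : {within `[smin, smax] `*` [set: R],
      continuous (fun p : R * R => F p.1 p.2)};
    mf_nondecreasing_x : forall s, s \in `[smin, smax] ->
      {homo F s : x y / x <= y};
    mf_nondecreasing_s : forall x,
      {in `[smin, smax] &, {homo F ^~ x : s t / s <= t}};
    mf_degree1 : forall s, s \in `[smin, smax] -> forall x,
      F s (x + 1) = F s x + 1;
    mf_flat_pos : (0 < m)%N;
    mf_flat_arc : forall s, s \in `[smin, smax] -> forall j,
      a j s < b j s < a j s + 1;
    mf_flat_disjoint : forall s, s \in `[smin, smax] -> forall i j : 'I_m, i != j ->
      circle_arc (a i s) (b i s) `&` circle_arc (a j s) (b j s) = set0;
    mf_flat_constant : forall s, s \in `[smin, smax] -> forall j x y,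
      circle_arc (a j s) (b j s) x -> circle_arc (a j s) (b j s) y -> f s x = f s y;
    mf_flat_continuous : forall j,
      {within `[smin, smax], continuous (a j)} /\
      {within `[smin, smax], continuous (b j)};
    mf_expanding : exists lambda : R, 1 < lambda /\
      forall s, s \in `[smin, smax] -> forall x,
        (forall j, ~ circle_arc (a j s) (b j s) (circle_proj x)) ->
        derivable (F s) x 1 /\ lambda < derive1 (F s) x;
    mf_heights : exists nu : R, 0 < nu /\
      forall s, s \in `[smin, smax] -> forall j, exists2 l : R,
        is_derive_within `[smin, smax] (fun t => F t (a j t)) s l & nu < l
  }.

(* That the choice of the base point 0 is immaterial, and that the limit exists,
   is part of what has to be proved about it. *)
Definition rotation_number (g : R -> R) : R :=
  lim ((iter n g 0 - 0) / n%:R @[n --> \oo]).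

Definition level_set smin smax (rho : R -> R) (r : R) : set R :=
  [set s | s \in `[smin, smax] /\ rho s = r].

(* p/q is represented by a number of type rat. *)
Definition plateau smin smax (rho : R -> R) (r : rat) : set R :=
  level_set smin smax rho (ratr r).

Definition right_endpoint (P : set R) (s : R) : Prop := P s /\ ubound P s.

Definition left_endpoint (P : set R) (s : R) : Prop := P s /\ lbound P s.

Definition irrational_params smin smax (rho : R -> R) : set R :=
  [set s | s \in `[smin, smax] /\ irrational (rho s)].

End MonotoneFamily.

Definition nowhere_dense (T : topologicalType) (A : set T) : Prop :=
  interior (closure A) = set0.

Section Hausdorff.
Variable R : realType.
Local Open Scope ereal_scope.
Implicit Types (A U : set R) (d : R).

Definition diam U : \bar R :=
  ereal_sup [set `|x - y|%:E | x in U & y in U].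

(* The empty set has weight 0 for every d; diam set0 is -oo, and 0 `^ 0 is 1. *)
Definition hausdorff_weight d U : \bar R :=
  if U == set0 then 0 else diam U `^ d.

Definition hausdorff_premeasure d (delta : R) A : \bar R :=
  ereal_inf [set \sum_(0 <= i <oo) hausdorff_weight d (U i) |
    U in [set U : nat -> set R | A `<=` \bigcup_i U i /\
                                 forall i, diam (U i) <= delta%:E]].

Definition hausdorff_measure d A : \bar R :=
  ereal_sup [set hausdorff_premeasure d delta A |
    delta in [set delta : R | (0 < delta)%R]].

Definition hausdorff_dim A : \bar R :=
  ereal_inf [set d%:E | d in [set d : R | (0 <= d)%R /\
                                          hausdorff_measure d A = 0]].

End Hausdorff.

(* Main.v *)
(* Follow the height of a flat spot under F s and under F t, where s < t.  The
   gap between the two orbits starts at size at least nu (t - s) and grows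
   geometrically, until after O(log (1 / (t - s))) steps the orbit for s is not
   beyond some flat spot of F s while the orbit for t has reached the same flat
   spot of F t.  One more step compares both orbits with the height of that
   flat spot.  There are finitely many flat spots, so some chain of such steps
   closes up, and it gives F s ^n h <= h + p at s and F t ^n h' >= h' + p at t.
   Hence there is a fraction p / n with rho s <= p / n <= rho t and
   n = O(log (1 / (t - s))).  This one estimate makes irrational levels points,
   gives 1 / Delta rho = O(log (1 / Delta s)) at the ends of plateaus, and, since
   there are O(N ^ 2) fractions of denominator at most N in a bounded interval,
   covers C by O(N ^ 2) sets of diameter exp (- c N), so that its dimension
   is 0. *)

Require Import Defs.
From mathcomp Require Import all_boot all_order all_algebra.
From mathcomp Require Import all_classical all_reals all_analysis.
From mathcomp Require Import borel_hierarchy.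
From mathcomp Require Import ring lra.

Set Implicit Arguments.
Unset Strict Implicit.
Unset Printing Implicit Defensive.

Import Order.TTheory GRing.Theory Num.Theory.
Import numFieldNormedType.Exports.

Local Open Scope classical_set_scope.
Local Open Scope ring_scope.

(** * Rotation numbers of monotone lifts of degree one *)

Section RotationNumber.
Variable R : realType.
Implicit Types (g : R -> R) (x y : R).

Definition degree1_monotone (g : R -> R) :=
  {homo g : x y / x <= y} /\ forall x, g (x + 1) = g x + 1.

Lemma natmul_bounded_le0 x (A : R) : (forall n : nat, n%:R * x <= A) -> x <= 0.
Proof.
move=> H; rewrite leNgt; apply/negP => x0.
have := H (Num.bound (A / x)); rewrite leNgt => /negP; apply.
by rewrite -ltr_pdivrMr// unstable.ltr_bound.
Qed.

Lemma degree1_shift g (p : int) x : degree1_monotone g ->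
  g (x + p%:~R) = g x + p%:~R.
Proof.
move=> [_ g1]; have natP (n : nat) y : g (y + n%:R) = g y + n%:R.
  by elim: n y => [|n IH] y; rewrite ?addr0// -natr1 addrA g1 IH addrA.
case: p => n; first exact: natP.
rewrite NegzE mulrNz; have := natP n.+1 (x - n.+1%:R); rewrite subrK => ->.
by rewrite addrK.
Qed.

Lemma iter_degree1 g n : degree1_monotone g -> degree1_monotone (iter n g).
Proof.
move=> [gm g1]; split; elim: n => [//|n IH] /=.
  by move=> x y xy; apply: gm; exact: IH.
by move=> x; rewrite IH g1.
Qed.

(** With [p = floor (x - y)], the point [x] lies in [[y + p, y + p + 1[]. As [g] commutes with
    integer translations, monotonicity traps [g x] between [g y + p] and [g y + p + 1]. *)
Lemma degree1_displacement g x y : degree1_monotone g ->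
  `|(g x - x) - (g y - y)| <= 1.
Proof.
move=> dg; have [gm _] := dg.
pose p := Num.floor (x - y).
have [p1 p2] : p%:~R <= x - y /\ x - y < p%:~R + 1.
  by split; [exact: floor_le|rewrite -intrD1; exact: floorD1_gt].
have h1 : g y + p%:~R <= g x by rewrite -degree1_shift//; apply: gm; lra.
have h2 : g x <= g y + p%:~R + 1.
  by rewrite -degree1_shift// -[_ + 1]dg.2; apply: gm; lra.
by rewrite ler_norml; lra.
Qed.

Lemma iter_mul_displacement g n k : degree1_monotone g ->
  `|iter (k * n) g 0 - k%:R * iter n g 0| <= k%:R.
Proof.
move=> dg; elim: k => [|k IH]; first by rewrite mul0n mul0r subr0 normr0.
rewrite mulSn iterD.
have := degree1_displacement (iter (k * n) g 0) 0 (iter_degree1 n dg).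
by move: IH; rewrite -natr1 !ler_norml; lra.
Qed.

(** Splitting [n k] steps into [k] blocks of [n] or [n] blocks of [k] shows that the intervals
    [[(u n - 1) / n, (u n + 1) / n]] meet pairwise. The supremum of their left ends therefore lies
    in all of them. *)
Lemma rotation_bound_exists g : degree1_monotone g ->
  exists r : R, forall n, `|iter n g 0 - n%:R * r| <= 1.
Proof.
move=> dg; pose u n := iter n g 0.
have quasi n k : `|k%:R * u n - n%:R * u k| <= n%:R + k%:R.
  have := iter_mul_displacement n k dg.
  have := iter_mul_displacement k n dg.
  by rewrite mulnC -/(u n) -/(u k) !ler_norml; lra.
pose E := [set x | exists n, x = (u n.+1 - 1) / n.+1%:R].
have posn n : (0 : R) < n.+1%:R by rewrite ltr0n.
have ubE k : ubound E ((u k.+1 + 1) / k.+1%:R).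
  move=> _ [n ->]; rewrite ler_pdivrMr// mulrAC ler_pdivlMr//.
  by have := quasi n.+1 k.+1; rewrite ler_norml; lra.
have E0 : E !=set0 by exists ((u 1%N - 1) / 1); exists 0%N.
exists (sup E) => -[|n]; first by rewrite mul0r subr0 normr0.
have h1 : (u n.+1 - 1) / n.+1%:R <= sup E.
  by apply: ub_le_sup; [exists ((u 1%N + 1) / 1); exact: ubE|exists n].
have h2 : sup E <= (u n.+1 + 1) / n.+1%:R by apply: ge_sup.
move: h1 h2; rewrite ler_pdivrMr// ler_pdivlMr// -/(u _).
by rewrite ler_norml; lra.
Qed.

Lemma bounded_displacement_cvg (v : nat -> R) r A :
  (forall n, `|v n - n%:R * r| <= A) -> v n / n%:R @[n --> \oo] --> r.
Proof.
move=> H; apply/cvgrPdist_le => e e0; near=> n.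
have n0 : (0 : R) < n%:R by rewrite ltr0n; near: n; exact: nbhs_infty_gt.
rewrite -(ler_pM2r n0) -[X in _ * X]gtr0_norm// -normrM mulrBl divfK ?gt_eqF//.
rewrite distrC mulrC; apply: (le_trans (H n)).
rewrite -ler_pdivrMl// mulrC; near: n; exact: nbhs_infty_ger.
Unshelve. all: by end_near. Qed.

Lemma rotation_number_dist g n : degree1_monotone g ->
  `|iter n g 0 - n%:R * rotation_number g| <= 1.
Proof.
move=> dg; have [r Hr] := rotation_bound_exists dg.
suff -> : rotation_number g = r by [].
apply/cvg_lim => //.
by apply: (bounded_displacement_cvg (A := 1)) => k; rewrite subr0.
Qed.

Lemma rotation_number_displacement g n x : degree1_monotone g ->
  `|iter n g x - x - n%:R * rotation_number g| <= 2.
Proof.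
move=> dg; have := rotation_number_dist n dg.
have := degree1_displacement x 0 (iter_degree1 n dg).
by rewrite !ler_norml; lra.
Qed.

Lemma rotation_number_cvg g x : degree1_monotone g ->
  (iter n g x - x) / n%:R @[n --> \oo] --> rotation_number g.
Proof.
move=> dg; apply: (bounded_displacement_cvg (A := 2)) => n.
exact: rotation_number_displacement.
Qed.

Lemma iter_le_shift g n (p : int) x k : degree1_monotone g ->
  iter n g x <= x + p%:~R -> iter (k * n) g x <= x + k%:R * p%:~R.
Proof.
move=> dg H; elim: k => [|k IH]; first by rewrite mul0n mul0r addr0.
have := (iter_degree1 n dg).1 _ _ IH.
rewrite mulSn iterD => /le_trans; apply.
rewrite (pmulrn 1 k) -intrM degree1_shift; last exact: iter_degree1.
by rewrite intrM -pmulrn -natr1; move: H; lra.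
Qed.

Lemma iter_ge_shift g n (p : int) x k : degree1_monotone g ->
  x + p%:~R <= iter n g x -> x + k%:R * p%:~R <= iter (k * n) g x.
Proof.
move=> dg H; elim: k => [|k IH]; first by rewrite mul0n mul0r addr0.
have := (iter_degree1 n dg).1 _ _ IH.
rewrite mulSn iterD; apply: le_trans.
rewrite (pmulrn 1 k) -intrM degree1_shift; last exact: iter_degree1.
by rewrite intrM -pmulrn -natr1; move: H; lra.
Qed.

(** The inequality persists for [k n] steps and shift [k p], while the displacement stays within 2
    of [k n] times the rotation number. So [k] times the difference of the two sides is at most 2
    for every [k]. *)
Lemma rotation_number_le g n (p : int) x : degree1_monotone g ->
  iter n g x <= x + p%:~R -> n%:R * rotation_number g <= p%:~R.
Proof.
move=> dg H; rewrite -subr_le0; apply: (natmul_bounded_le0 (A := 2)) => k.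
have := iter_le_shift k dg H.
have := rotation_number_displacement (k * n) x dg.
by rewrite ler_norml natrM; lra.
Qed.

Lemma rotation_number_ge g n (p : int) x : degree1_monotone g ->
  x + p%:~R <= iter n g x -> p%:~R <= n%:R * rotation_number g.
Proof.
move=> dg H; rewrite -subr_le0; apply: (natmul_bounded_le0 (A := 2)) => k.
have := iter_ge_shift k dg H.
have := rotation_number_displacement (k * n) x dg.
by rewrite ler_norml natrM; lra.
Qed.

Lemma iter_le g1 g2 n x y : degree1_monotone g1 ->
  (forall x, g1 x <= g2 x) -> x <= y -> iter n g1 x <= iter n g2 y.
Proof.
move=> dg g12 xy; elim: n => //= n IH.
exact: le_trans (dg.1 _ _ IH) (g12 _).
Qed.

Lemma rotation_number_mono g1 g2 : degree1_monotone g1 -> degree1_monotone g2 ->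
  (forall x, g1 x <= g2 x) -> rotation_number g1 <= rotation_number g2.
Proof.
move=> d1 d2 g12; rewrite -subr_le0; apply: (natmul_bounded_le0 (A := 2)) => n.
have := iter_le n d1 g12 (lexx 0).
have := rotation_number_dist n d1; have := rotation_number_dist n d2.
by rewrite !ler_norml; lra.
Qed.

End RotationNumber.


(** * Continuous induction on an interval *)

Section RealInduction.
Variable R : realType.

Lemma within_continuous_distP (A : set R) (h : R -> R) :
  {within A, continuous h} <-> forall s, A s -> forall e, 0 < e ->
    exists2 d, 0 < d & forall t, A t -> `|t - s| < d -> `|h t - h s| < e.
Proof.
split=> [/subspace_continuousP H s As e e0|H].
  have /cvgrPdist_lt/(_ e e0)[d /= d0 Hd] := H s As.
  exists d => // t At ts; rewrite distrC; apply: Hd => //=.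
  by rewrite distrC.
apply/subspace_continuousP => s As; apply/cvgrPdist_lt => e e0.
have [d d0 Hd] := H s As e e0; exists d => //= t ts At.
by rewrite distrC; apply: Hd => //; rewrite distrC.
Qed.

(** This stands in for compactness. The supremum of the points up to which [P] holds throughout
    satisfies [P] by the left step, and by the right step it cannot lie before [b]. *)
Lemma real_induction (a b : R) (P : R -> Prop) : a <= b -> P a ->
  (forall x, a <= x < b -> P x ->
    exists2 y, x < y & forall z, x < z <= y -> z <= b -> P z) ->
  (forall x, a < x <= b -> (forall z, a <= z < x -> P z) -> P x) -> P b.
Proof.
move=> ab Pa right left.
pose S := [set x | a <= x <= b /\ forall z, a <= z <= x -> P z].
have Sa : S a by split=> [|z za]; rewrite ?lexx// (_ : z = a)//; apply/le_anti; lra.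
have ubS : ubound S b by move=> x [/andP[]].
have ac : a <= sup S by apply: ub_le_sup => //; exists b.
have cb : sup S <= b by apply: ge_sup => //; exists a.
have Pl z : a <= z < sup S -> P z.
  move=> /andP[az zc].
  have [||x [_ Px]] := @sup_adherent R S (sup S - z); first by rewrite subr_gt0.
    by split; [exists a|exists b].
  by move=> xz; apply: Px; lra.
have Pc : P (sup S).
  have [<-//|ac'] := eqVneq a (sup S).
  by apply: left => //; rewrite cb andbT lt_neqAle ac' ac.
have [<-//|cb'] := eqVneq (sup S) b.
have cltb : sup S < b by rewrite lt_neqAle cb' cb.
have [|y cy Py] := right (sup S) _ Pc; first by rewrite ac.
have : S (Num.min y b).
  split=> [|z /andP[az]]; first by rewrite ge_min lexx orbT le_min; lra.
  rewrite le_min => /andP[zy zb].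
  have [cz|zc] := ltP (sup S) z; first by apply: Py; rewrite ?cz.
  have [->//|nzc] := eqVneq z (sup S).
  by apply: Pl; rewrite az lt_neqAle nzc zc.
by move/(ub_le_sup (ex_intro _ b ubS)); rewrite ge_min; lra.
Qed.

(** Continuous induction on [h a <= h x]: the one-sided hypothesis gives the right step, continuity
    the left one. *)
Lemma right_local_nondecreasing (a b : R) (h : R -> R) : a <= b ->
  {within `[a, b], continuous h} ->
  (forall x, a <= x < b ->
    exists2 d, 0 < d & forall z, x < z < x + d -> z <= b -> h x <= h z) ->
  h a <= h b.
Proof.
move=> ab /within_continuous_distP hc right.
apply: (real_induction (a := a) (b := b) (P := fun x => h a <= h x)) => // [x xab hx|x xab Hx].
  have [d d0 Hd] := right x xab.
  exists (x + d / 2) => [|z zx zb]; first lra.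
  by apply: le_trans hx _; apply: Hd => //; lra.
rewrite leNgt; apply/negP => hxa.
have xI : x \in `[a, b] by rewrite in_itv /=; lra.
have [|d d0 Hd] := hc x xI (h a - h x); first lra.
pose z := Num.max a (x - d / 2).
have [az zd zx] : [/\ a <= z, x - d / 2 <= z & z < x].
  by rewrite /z le_max lexx le_max lexx orbT gt_max; split => //; lra.
have := Hx z; rewrite az zx => /(_ isT) haz.
have : `|h z - h x| < h a - h x.
  by apply: Hd; [rewrite /= in_itv/=; lra|rewrite ltr_norml; lra].
by rewrite ltr_norml; lra.
Qed.

End RealInduction.

(** * Points and arcs of the circle in terms of lifts *)

Section Circle.
Variable R : realType.
Implicit Types x y : R.

Lemma circle_projP x y :
  circle_proj x = circle_proj y <-> exists p : int, x = y + p%:~R.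
Proof.
have -> : (circle_proj x = circle_proj y) <-> eqmodZ x y.
  by split=> [/eqmodP|/eqmodP].
split=> [/intrP[p xyp]|[p ->]]; first by exists p; lra.
by rewrite /eqmodZ addrAC subrr add0r; apply/intrP; exists p.
Qed.

Lemma circle_arcP (a b x : R) : circle_arc a b (circle_proj x) <->
  exists p : int, a + p%:~R <= x <= b + p%:~R.
Proof.
split=> [[y /= + /esym/circle_projP[p ->]]|[p xp]].
  by rewrite in_itv /= => yab; exists p; lra.
exists (x - p%:~R); first by rewrite /= in_itv /=; lra.
by apply/esym/circle_projP; exists p; lra.
Qed.

End Circle.

(** * Continuity, flat spots, expansion and heights of a monotone family *)

Section MonotoneFamily.
Variables (R : realType) (smin smax : R).
Variables (f : R -> circle R -> circle R) (F : R -> R -> R).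
Variables (m : nat) (a b : 'I_m -> R -> R).
Hypothesis Hfam : monotone_family smin smax f F a b.
Local Notation J := `[smin, smax].
Local Notation rho := (fun s => rotation_number (F s)).

Lemma family_degree1 s : s \in J -> degree1_monotone (F s).
Proof.
by move=> sI; split; [exact: mf_nondecreasing_x Hfam _ sI|exact: mf_degree1 Hfam _ sI].
Qed.

Lemma family_le s t x : s \in J -> t \in J -> s <= t -> F s x <= F t x.
Proof. exact: (mf_nondecreasing_s Hfam). Qed.

Lemma family_continuous_distP s x e : s \in J -> 0 < e ->
  exists2 d, 0 < d & forall t y, t \in J -> `|t - s| < d -> `|y - x| < d ->
    `|F t y - F s x| < e.
Proof.
move=> sI e0; have /subspace_continuousP/(_ (s, x)) := mf_lift_continuous Hfam.
move=> /(_ (conj sI I)) /cvgrPdist_lt/(_ e e0)[[U V] /= [[d1 /= d10 H1] [d2 /= d20 H2]] H].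
exists (Num.min d1 d2) => [|t y tI]; first by rewrite lt_min d10.
rewrite !lt_min => /andP[ts _] /andP[_ yx].
rewrite distrC; apply: (H (t, y)) => /=; last by split.
by split; [apply: H1|apply: H2]; rewrite /= distrC.
Qed.

Lemma family_continuous s : s \in J -> continuous (F s).
Proof.
move=> sI x; apply/cvgrPdist_lt => e e0.
have [d d0 H] := family_continuous_distP x sI e0.
exists d => //= y yx; rewrite distrC; apply: H => //; last by rewrite distrC.
by rewrite subrr normr0.
Qed.

Lemma family_comp_continuous (h : R -> R) : {within [set` J], continuous h} ->
  {within [set` J], continuous (fun t => F t (h t))}.
Proof.
move=> /within_continuous_distP ch; apply/within_continuous_distP => s sI e e0.
have [d d0 H] := family_continuous_distP (h s) sI e0.
have [d' d'0 H'] := ch s sI d d0.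
exists (Num.min d d') => [|t tI]; first by rewrite lt_min d0.
by rewrite lt_min => /andP[t1 t2]; apply: H => //; apply: H'.
Qed.

Lemma family_iter_continuous n x :
  {within [set` J], continuous (fun t => iter n (F t) x)}.
Proof.
elim: n => [|n IH] /=; last exact: family_comp_continuous.
by apply: continuous_subspaceT => y; exact: cvg_cst.
Qed.

Lemma rotation_number_nondecreasing :
  {in J &, {homo rho : s t / s <= t}}.
Proof.
move=> s t sI tI st; apply: rotation_number_mono => [||x].
- exact: family_degree1.
- exact: family_degree1.
- exact: family_le.
Qed.

Lemma rotation_number_continuous : {within [set` J], continuous rho}.
Proof.
apply/within_continuous_distP => s sI e e0.
(* For parameters [s] and [t], [n * rho] is within 1 of the [n]-th iterate at 0. If these iterates
   differ by less than 1, the values of [n * rho] differ by less than 3, while [n * e > 4]. *)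
pose n := (Num.bound (4 / e)).+1.
have n0 : (0 : R) < n%:R by rewrite ltr0n.
have ne : 4 < n%:R * e.
  rewrite -ltr_pdivrMr//; apply: lt_trans (unstable.ltr_bound _) _.
  by rewrite ltr_nat.
have [|d d0 H] := (within_continuous_distP _ _).1
  (family_iter_continuous (n := n) (x := 0)) s sI 1; first exact: ltr01.
exists d => // t tI ts; have := H t tI ts.
have := rotation_number_dist n (family_degree1 sI).
have := rotation_number_dist n (family_degree1 tI).
move: ne; rewrite !ler_norml !ltr_norml => ne ut us uts.
by apply/andP; split; rewrite -(ltr_pM2l n0); lra.
Qed.

(** Constancy of [f s] on the arc fixes the lift there only up to integers. A nonzero integer at the
    right end would, by the intermediate value theorem, force the value [F s (a j s) + 1 / 2]
    inside. *)
Lemma family_flat s j (p : int) : s \in J ->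
  F s (b j s + p%:~R) = F s (a j s) + p%:~R.
Proof.
move=> sI; rewrite degree1_shift; last exact: family_degree1.
congr (_ + _); have /andP[ab _] := mf_flat_arc Hfam sI j.
have flat x : a j s <= x <= b j s -> exists p : int, F s x = F s (a j s) + p%:~R.
  move=> xab; apply/circle_projP; rewrite !(mf_lift Hfam)//.
  by apply: (mf_flat_constant Hfam sI (j := j)); apply/circle_arcP; exists 0;
    rewrite !addr0; lra.
have Fab : F s (a j s) <= F s (b j s) by apply: (family_degree1 sI).1; exact: ltW.
have [q Fb] : exists p : int, F s (b j s) = F s (a j s) + p%:~R.
  by apply: flat; rewrite lexx ltW.
have [q0|q0] := leP q 0.
  by apply/le_anti; rewrite Fab Fb andbT gerDl lerz0.
have q1 : (1 : R) <= q%:~R by rewrite ler1z -gtz0_ge1.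
have [||c] := @IVT R (F s) (a j s) (b j s) (F s (a j s) + 1 / 2) (ltW ab).
- exact/continuous_subspaceT/family_continuous.
- by rewrite min_l// max_r// Fb; lra.
rewrite in_itv /= => cab Fc; have [r Fr] := flat c cab.
have : (r%:~R : R) = 1 / 2 by lra.
have [r0|r0] := leP r 0.
  by have : (r%:~R : R) <= 0 by [rewrite lerz0]; lra.
by have : (1 : R) <= r%:~R by [rewrite ler1z -gtz0_ge1]; lra.
Qed.

Lemma family_expanding : exists2 lam, 1 < lam &
  forall s x y, s \in J -> x <= y ->
    (forall z j (p : int), x < z < y ->
       ~ (a j s + p%:~R <= z <= b j s + p%:~R)) ->
    lam * (y - x) <= F s y - F s x.
Proof.
have [lam [lam1 H]] := mf_expanding Hfam.
exists lam => // s x y sI xy nflat.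
have [<-|xney] := eqVneq x y; first by rewrite !subrr mulr0.
have ltxy : x < y by rewrite lt_neqAle xney.
have dF z : z \in `]x, y[ -> derivable (F s) z 1 /\ lam < derive1 (F s) z.
  rewrite in_itv /= => zxy; apply: (H s sI) => j /circle_arcP[p].
  exact: nflat.
have [||z zxy ->] := @MVT R (F s) (derive1 (F s)) x y ltxy.
- by move=> z /dF[dz _]; rewrite derive1E; exact: derivableP.
- exact/continuous_subspaceT/family_continuous.
by have [_ /ltW] := dF z zxy; apply: ler_wpM2r; rewrite subr_ge0.
Qed.

(** The derivative within [J] exceeds [nu], so [F u (a j u) - nu * u] does not drop just to the
    right of any parameter; [right_local_nondecreasing] makes this global. *)
Lemma height_growth : exists2 nu, 0 < nu & forall j s t, s \in J -> t \in J ->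
  s <= t -> nu * (t - s) <= F t (a j t) - F s (a j s).
Proof.
have [nu [nu0 H]] := mf_heights Hfam; exists nu => // j s t sI tI st.
move: (sI) (tI); rewrite !in_itv /= => sI' tI'.
pose h u := F u (a j u) - nu * u.
suff : h s <= h t by rewrite /h; lra.
have cF : {within [set` J], continuous (fun u => F u (a j u))}.
  by apply: family_comp_continuous; exact: (mf_flat_continuous Hfam j).1.
apply: right_local_nondecreasing => //.
  have : {within [set` J], continuous h}.
    apply/subspace_continuousP => u uI; apply: cvgB.
      by move/subspace_continuousP : cF; exact.
    by apply: cvgM; [exact: cvg_cst|exact: cvg_within].
  by apply: continuous_subspaceW => u /=; rewrite !in_itv /=; lra.
move=> u ust; have uI : u \in J by rewrite in_itv /=; lra.
have [l Hl nul] := H u uI j.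
have lnu : 0 < l - nu by rewrite subr_gt0.
have /cvgrPdist_lt/(_ _ lnu)[d /= d0 Hd] := Hl.
exists d => // v vu vt.
have vI : v \in J by rewrite in_itv /=; lra.
have vu0 : 0 < v - u by lra.
have : `|l - (F v (a j v) - F u (a j u)) / (v - u)| < l - nu.
  apply: Hd => //=; first by rewrite distrC gtr0_norm//; lra.
  by rewrite gt_eqF//; lra.
move=> /ltr_normlP[_ Hq].
have : nu < (F v (a j v) - F u (a j u)) / (v - u) by lra.
rewrite ltr_pdivlMr// /h; lra.
Qed.

(** Disjointness of the arcs, and length below 1 for a single arc, keep left ends from meeting right
    ends modulo 1. For each pair of indices only two consecutive integers [p] compete for the
    minimum, and there are finitely many pairs. *)
Lemma flat_separation s : s \in J -> exists2 eta : R, 0 < eta <= 1 &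
  forall k l (p : int), eta <= `|a k s + p%:~R - b l s|.
Proof.
move=> sI.
have nz k l (p : int) : a k s + p%:~R != b l s.
  apply/eqP => akl; have /andP[ab1 ab2] := mf_flat_arc Hfam sI k.
  have [kl|kl] := eqVneq k l.
    move: akl; rewrite -kl => akl.
    have : (0 : R) < p%:~R by lra.
    have : (p%:~R : R) < 1 by lra.
    by rewrite ltr0z ltrz1 gtz0_ge1 leNgt => ->.
  have := mf_flat_disjoint Hfam sI kl.
  move=> /seteqP[+ _] => /(_ (circle_proj (b l s))); apply; split.
    by apply/circle_arcP; exists p; lra.
  have /andP[abl _] := mf_flat_arc Hfam sI l.
  by apply/circle_arcP; exists 0; lra.
have sep (k l : 'I_m) : exists2 e : R, 0 < e <= 1 &
    forall p : int, e <= `|a k s + p%:~R - b l s|.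
  pose q := Num.floor (b l s - a k s).
  have q1 : q%:~R <= b l s - a k s by exact: floor_le.
  have q2 : b l s - a k s < q%:~R + 1 by rewrite -intrD1; exact: floorD1_gt.
  have q3 : a k s + q%:~R < b l s by rewrite lt_neqAle nz; lra.
  exists (Num.min (b l s - a k s - q%:~R) (q%:~R + 1 - (b l s - a k s))).
    by rewrite lt_min ge_min; lra.
  move=> p; rewrite ge_min.
  have [pq|qp] := leP p q.
    have pqR : (p%:~R : R) <= q%:~R by rewrite ler_int.
    by apply/orP; left; rewrite distrC ler_normr; lra.
  have qpR : (q%:~R + 1 : R) <= p%:~R by rewrite -intrD1 ler_int lezD1.
  by apply/orP; right; rewrite ler_normr; lra.
pose e (kl : 'I_m * 'I_m) := projT1 (cid2 (sep kl.1 kl.2)).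
have eP kl : 0 < e kl <= 1 /\ forall p : int, e kl <= `|a kl.1 s + p%:~R - b kl.2 s|.
  by rewrite /e; case: cid2.
exists (\big[Num.min/1]_kl e kl).
  elim/big_ind: _ => [|x y x0 y0|kl _]; first by rewrite ltr01 lexx.
    by rewrite lt_min ge_min; lra.
  exact: (eP kl).1.
move=> k l p; apply: le_trans ((eP (k, l)).2 p).
exact: bigmin_le_cond.
Qed.

End MonotoneFamily.

(** Pigeonhole on the first [#|T| + 1] iterates; it is what closes up the chain of flat spots. *)
Lemma iter_returns (T : finType) (g : T -> T) (x0 : T) :
  exists x n, [/\ (0 < n)%N, (n <= #|T|)%N & iter n g x = x].
Proof.
pose h (i : 'I_#|T|.+1) := iter i g x0.
have /injectivePn[i [j ij hij]] : ~~ injectiveb h.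
  by apply/injectiveP => /leq_card; rewrite card_ord ltnn.
wlog ltij : i j ij hij / (i < j)%N => [H|].
  have [ltij|ltji|eij] := ltngtP i j; last by case/eqP: ij; exact: val_inj.
    exact: (H i j).
  by apply: (H j i) => //; rewrite eq_sym.
exists (h i), (j - i)%N; split; first by rewrite subn_gt0.
  by rewrite (leq_trans (leq_subr _ _))// -ltnS.
by rewrite /h -iterD subnK// ltnW.
Qed.

(** * Growth of the gap between the orbits of two parameters *)

Section Separation.
Variables (R : realType) (smin smax : R).
Variables (f : R -> circle R -> circle R) (F : R -> R -> R).
Variables (m : nat) (a b : 'I_m -> R -> R).
Hypothesis Hfam : monotone_family smin smax f F a b.
Local Notation J := `[smin, smax].
Local Notation rho := (fun s => rotation_number (F s)).
Local Notation height j s := (F s (a j s)).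

(** The right end is taken at [s] and the left end at [t], so that one more step puts [x] at most at
    the height for [s] and [y] at least at the height for [t], both shifted by [p]. *)
Definition straddles (s t x y : R) (k : 'I_m) (p : int) :=
  x <= b k s + p%:~R /\ a k t + p%:~R <= y.

Lemma straddles_height s t x y k p : s \in J -> t \in J ->
  straddles s t x y k p ->
  F s x <= height k s + p%:~R /\ height k t + p%:~R <= F t y.
Proof.
move=> sJ tJ [xb ay]; rewrite -(family_flat Hfam)//.
rewrite -(degree1_shift p (a k t) (family_degree1 Hfam tJ)).
by split; apply: (family_degree1 Hfam _).1.
Qed.

Lemma flats_near s0 e : s0 \in J -> 0 < e -> exists2 d, 0 < d &
  forall s, s \in J -> `|s - s0| < d ->
    forall j, `|a j s - a j s0| < e /\ `|b j s - b j s0| < e.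
Proof.
move=> s0J e0.
have near1 j : exists2 d, 0 < d & forall s, s \in J -> `|s - s0| < d ->
    `|a j s - a j s0| < e /\ `|b j s - b j s0| < e.
  have [/within_continuous_distP ca /within_continuous_distP cb] :=
    mf_flat_continuous Hfam j.
  have [d1 d10 H1] := ca s0 s0J e e0; have [d2 d20 H2] := cb s0 s0J e e0.
  exists (Num.min d1 d2) => [|s sJ]; first by rewrite lt_min d10.
  by rewrite lt_min => /andP[s1 s2]; split; [apply: H1|apply: H2].
pose d j := projT1 (cid2 (near1 j)).
have dP j : 0 < d j /\ forall s, s \in J -> `|s - s0| < d j ->
    `|a j s - a j s0| < e /\ `|b j s - b j s0| < e.
  by rewrite /d; case: cid2.
exists (\big[Num.min/1]_j d j) => [|s sJ ss j].
  elim/big_ind: _ => [|x y x0 y0|j _]; [exact: ltr01| |exact: (dP j).1].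
  by rewrite lt_min x0.
apply: (dP j).2 => //; apply: lt_le_trans ss _; exact: bigmin_le_cond.
Qed.

(* When no flat spot is straddled but [x, y] meets flat spots of both F s and
   F t, these are different, so [x, y] is long while only its part of length
   2 e next to y can meet a flat spot of F s. *)
Lemma straddle_or_expand s0 : s0 \in J -> exists d lam, [/\ 0 < d, 1 < lam &
  forall s t x y, s \in J -> t \in J -> `|s - s0| < d -> `|t - s0| < d ->
    s <= t -> x <= y ->
    (exists k p, straddles s t x y k p) \/
    y - x < 2 /\ lam * (y - x) <= F t y - F s x].
Proof.
move=> s0J.
have [lam lam1 expand] := family_expanding Hfam.
have [eta /andP[eta0 eta1] sep] := flat_separation Hfam s0J.
(* The loss [lam * (2 * e)] is then [eta * (lam - 1) / 4]. Lowering the rate from [lam] to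
   [(1 + lam) / 2] absorbs it as soon as [y - x >= eta / 2]. *)
pose e := eta * (lam - 1) / (8 * lam).
have lam0 : 0 < 8 * lam by lra.
have eE : e * (8 * lam) = eta * (lam - 1) by rewrite /e divfK ?gt_eqF.
have e0 : 0 < e by rewrite divr_gt0// mulr_gt0//; lra.
have ee : 8 * e < eta.
  rewrite -(ltr_pM2r (_ : 0 < lam)); last by lra.
  by rewrite -subr_gt0; lra.
have [d d0 near] := flats_near s0J e0.
exists d, ((1 + lam) / 2); split=> // [|s t x y sJ tJ sd td st xy]; first by lra.
have [hit|nohit] := EM (exists k p, straddles s t x y k p); first by left.
right; have nA j := near s sJ sd j; have nB j := near t tJ td j.
split.
  rewrite ltNge; apply/negP => xy2; apply: nohit.
  pose k := Ordinal (mf_flat_pos Hfam).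
  (* The first copy of flat spot [k] that ends at or after [x]: it starts before [x + 1] for [s],
     hence before [x + 2 <= y] for [t]. *)
  exists k, (Num.ceil (x - b k s)).
  have c1 : x - b k s <= (Num.ceil (x - b k s))%:~R by exact: ceil_ge.
  have c2 : (Num.ceil (x - b k s))%:~R < x - b k s + 1.
    by rewrite -ltrBlDr; have := ceilB1_lt (x - b k s); rewrite intrB.
  have /andP[ab _] := mf_flat_arc Hfam sJ k.
  move: (nA k) (nB k); rewrite /straddles !ltr_norml; lra.
have lamxy : (1 + lam) / 2 * (y - x) <= lam * (y - x).
  by apply: ler_wpM2r; lra.
(* If [[x, y]] misses all flat spots of one of the two maps, that map expands it, and monotonicity
   in the parameter replaces one endpoint value by that of the other map. *)
have [[k [p [xb ay]]]|noflatt] :=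
    EM (exists k (p : int), x <= b k t + p%:~R /\ a k t + p%:~R <= y); last first.
  apply: le_trans lamxy _; apply: le_trans (_ : F t y - F t x <= _).
    apply: expand => // z j p zxy zj; apply: noflatt; exists j, p; lra.
  by rewrite lerB//; exact: (family_le Hfam).
have [[l [q [xb' ay']]]|noflats] :=
    EM (exists k (p : int), x <= b k s + p%:~R /\ a k s + p%:~R <= y); last first.
  apply: le_trans lamxy _; apply: le_trans (_ : F s y - F s x <= _).
    apply: expand => // z j r zxy zj; apply: noflats; exists j, r; lra.
  by rewrite lerB//; exact: (family_le Hfam).
have bx : b k s + p%:~R < x.
  by rewrite ltNge; apply/negP => xbs; apply: nohit; exists k, p.
have ya : y < a l t + q%:~R.
  by rewrite ltNge; apply/negP => aty; apply: nohit; exists l, q.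
(* Copy [p] of flat spot [k] ends near [x] and copy [q] of flat spot [l] starts near [y], so the
   separation of ends at [s0] applies. *)
have long : eta - 2 * e <= y - x.
  have := sep l k (q - p); rewrite intrB ler_normr.
  by move: (nA k) (nB k) (nA l) (nB l); rewrite !ltr_norml; lra.
apply: le_trans (_ : F s (y - 2 * e) - F s x <= _); last first.
  have : F s (y - 2 * e) <= F s y.
    by apply: (family_degree1 Hfam sJ).1; lra.
  have := family_le Hfam y sJ tJ st; lra.
apply: le_trans (_ : lam * (y - 2 * e - x) <= _); last first.
  apply: expand => //; first by lra.
  move=> z j r zxy zj; apply: nohit; exists j, r.
  move: (nA j) (nB j); rewrite /straddles !ltr_norml; lra.
have : (lam - 1) * (3 / 4 * eta) <= (lam - 1) * (y - x).
  by apply: ler_wpM2l; lra.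
by move: eE; lra.
Qed.

Lemma iter_height_shift n s k (p : int) : s \in J ->
  iter n (F s) (height k s + p%:~R) = iter n (F s) (height k s) + p%:~R.
Proof.
move=> sJ; rewrite degree1_shift//; apply: iter_degree1.
exact: (family_degree1 Hfam).
Qed.

(** Until the first straddle the gap is multiplied by at least [lam] at each step and yet stays
    below 2, while it starts at size at least [nu * (t - s)]. *)
Lemma first_straddle s0 : s0 \in J -> exists d lam K, [/\ 0 < d, 1 < lam &
  forall s t j, s \in J -> t \in J -> `|s - s0| < d -> `|t - s0| < d -> s < t ->
    exists n k (p : int), [/\ (0 < n)%N,
      iter n (F s) (height j s) <= height k s + p%:~R,
      height k t + p%:~R <= iter n (F t) (height j t) &
      (t - s) * lam ^+ n <= K]].
Proof.
move=> s0J; have [d [lam [d0 lam1 H]]] := straddle_or_expand s0J.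
have [nu nu0 grow] := height_growth Hfam.
(* A first straddle at index [i + 1] bounds the gap at index [i], and the heights are compared one
   step later, hence [lam ^+ 2]. The second term covers a straddle at index 0. *)
exists d, lam, (2 * lam ^+ 2 / nu + (smax - smin) * lam); split=> //.
move=> s t j sJ tJ sd td st.
pose x i := iter i (F s) (height j s); pose y i := iter i (F t) (height j t).
pose hit i := exists k p, straddles s t (x i) (y i) k p.
have nuts : 0 < nu * (t - s) by rewrite mulr_gt0// subr_gt0.
have lamn i : 0 < lam ^+ i by rewrite exprn_gt0//; lra.
have long n : (forall i, (i < n)%N -> ~ hit i) ->
    x n <= y n /\ lam ^+ n * (nu * (t - s)) <= y n - x n.
  elim: n => [_|n IH nohit].
    have := grow j s t sJ tJ (ltW st); rewrite /x /y /= expr0 mul1r; lra.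
  have [xy Ln] := IH (fun i ni => nohit i (ltnW ni)).
  have [/(nohit n (ltnSn n))//|[_ Hn]] := H s t (x n) (y n) sJ tJ sd td (ltW st) xy.
  have : lam * (lam ^+ n * (nu * (t - s))) <= lam * (y n - x n).
    by apply: ler_wpM2l => //; lra.
  have : 0 < lam * (lam ^+ n * (nu * (t - s))).
    by rewrite !mulr_gt0//; lra.
  by rewrite exprS -mulrA /x /y /=; rewrite -/(x n) -/(y n); lra.
have short n : (forall i, (i <= n)%N -> ~ hit i) -> lam ^+ n * (nu * (t - s)) < 2.
  move=> nohit; have [xy Ln] := long n (fun i ni => nohit i (ltnW ni)).
  have [/(nohit n (leqnn n))//|[? _]] := H s t (x n) (y n) sJ tJ sd td (ltW st) xy.
  by lra.
(* Otherwise [lam ^+ n] would stay bounded, against Bernoulli's inequality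
   [n * (lam - 1) <= lam ^+ n]. *)
have exhit : exists i, `[< hit i >].
  apply: contrapT => nohit.
  suff : (lam - 1) * (nu * (t - s)) <= 0 by rewrite leNgt mulr_gt0//; lra.
  apply: (natmul_bounded_le0 (A := 2)) => n.
  have /ltW := short n (fun i _ hi => nohit (ex_intro _ i (asboolT hi))).
  apply: le_trans; rewrite [leLHS]mulrA ler_pM2r//.
  elim: n => [|n IH]; first by rewrite mul0r expr0.
  have : 1 <= lam ^+ n by rewrite exprn_ege1// ltW.
  have : lam ^+ n * (lam - 1) >= 1 * (lam - 1).
    by apply: ler_wpM2r; [lra|rewrite exprn_ege1// ltW].
  by move: IH; rewrite -natr1 exprS; lra.
have [n [hn minn]] : exists n, hit n /\ forall i, (i < n)%N -> ~ hit i.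
  case: (ex_minnP exhit) => i /asboolP hi mini; exists i; split=> // l li hl.
  by have := mini l (asboolT hl); rewrite leqNgt li.
have [k [p /(straddles_height sJ tJ)[h1 h2]]] := hn.
exists n.+1, k, p; split=> //.
have J1 : t - s <= smax - smin by move: sJ tJ; rewrite !in_itv /=; lra.
have T1 : 0 <= 2 * lam ^+ 2 / nu by apply: divr_ge0; [have := lamn 2%N; lra|exact: ltW].
have T2 : 0 <= (smax - smin) * lam by apply: mulr_ge0; lra.
case: n hn minn h1 h2 => [_ _ _ _|i _ mini _ _].
  by rewrite expr1; have : (t - s) * lam <= (smax - smin) * lam; [apply: ler_wpM2r; lra|lra].
have /ltW := short i mini; rewrite mulrCA mulrC.
rewrite -ler_pdivlMr// => hi.
suff : (t - s) * lam ^+ i.+2 <= 2 * lam ^+ 2 / nu by lra.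
rewrite -addn2 exprD mulrA (mulrC (t - s)).
apply: (le_trans (ler_wpM2r _ hi)); first by rewrite ltW.
by rewrite mulrAC.
Qed.

End Separation.

(* Up to a bounded factor, the distance of two parameters is exponentially
   small in the least denominator of a fraction between their rho-values. *)
Definition rational_between (R : realType) (rho : R -> R) (x y : R) :=
  exists c K, [/\ 0 < c, 0 < K &
    forall s t, x <= s -> s < t -> t <= y -> exists n (p : int), [/\ (0 < n)%N,
      n%:R * rho s <= p%:~R, p%:~R <= n%:R * rho t & (t - s) * expR (c * n%:R) <= K]].

(** * Fractions between the rotation numbers of two parameters *)

Section RationalBetween.
Variables (R : realType) (smin smax : R).
Variables (f : R -> circle R -> circle R) (F : R -> R -> R).
Variables (m : nat) (a b : 'I_m -> R -> R).
Hypothesis Hfam : monotone_family smin smax f F a b.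
Local Notation J := `[smin, smax].
Local Notation rho := (fun s => rotation_number (F s)).
Local Notation height j s := (F s (a j s)).

Lemma rational_between_local s0 : s0 \in J -> exists2 d, 0 < d &
  forall x y, x \in J -> y \in J -> `|x - s0| < d -> `|y - s0| < d ->
    rational_between rho x y.
Proof.
move=> s0J; have [d [lam [K [d0 lam1 H]]]] := first_straddle Hfam s0J.
have m0 := mf_flat_pos Hfam.
have m0R : (0 : R) < m%:R by rewrite ltr0n.
(* A closed chain has at most [m] links, each no longer than the longest one, to which the bound of
   [first_straddle] applies. This divides the rate [ln lam] by [m]. *)
exists d => // x y xJ yJ xd yd; exists (ln lam / m%:R), (Num.max 1 K); split.
- by rewrite divr_gt0// ln_gt0.
- by rewrite lt_max ltr01.
move=> s t xs st ty.
have [sJ tJ sd td] : [/\ s \in J, t \in J, `|s - s0| < d & `|t - s0| < d].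
  by move: xJ yJ xd yd; rewrite !in_itv /= !ltr_norml; split; lra.
pose Q j (w : nat * 'I_m * int) := [/\ (0 < w.1.1)%N,
      iter w.1.1 (F s) (height j s) <= height w.1.2 s + w.2%:~R,
      height w.1.2 t + w.2%:~R <= iter w.1.1 (F t) (height j t) &
      (t - s) * lam ^+ w.1.1 <= K].
have exQ j : exists w, Q j w.
  have [n [k [p Hnkp]]] := H s t j sJ tJ sd td st.
  by exists (n, k, p).
have [w Hw] := choice exQ.
pose N := \max_j (w j).1.1; pose g j := (w j).1.2.
have [j [i [i0 im gi]]] := iter_returns g (Ordinal m0).
rewrite card_ord in im.
have KN : (t - s) * lam ^+ N <= K.
  have [jm <-] : exists j, (w j).1.1 = N.
    have im0 : (0 < #|'I_m|)%N by rewrite card_ord.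
    by have [jm jmE] := @bigop.eq_bigmax 'I_m (fun j => (w j).1.1) im0; exists jm.
  by have [] := Hw jm.
(* Along the chain the step counts and the integer shifts add up. Each link takes between 1 and [N]
   steps; [i <= n] later makes the denominator positive. *)
have [n [p [n1 n2 n3 n4]]] : exists n (p : int), [/\ (i <= n)%N, (n <= i * N)%N,
    iter n (F s) (height j s) <= height (iter i g j) s + p%:~R &
    height (iter i g j) t + p%:~R <= iter n (F t) (height j t)].
  elim: i {i0 im gi} => [|i [n [p [n1 n2 n3 n4]]]].
    by exists 0%N, 0; rewrite /= !addr0 !lexx.
  set k := iter i g j in n3 n4 *; have [w1 w2 w3 w4] := Hw k.
  exists ((w k).1.1 + n)%N, ((w k).2 + p); split.
  - by rewrite -add1n leq_add.
  - rewrite mulSn leq_add//; exact: (@bigop.leq_bigmax 'I_m (fun j => (w j).1.1)).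
  - rewrite iterD intrD addrA; apply: (@le_trans _ _ (iter (w k).1.1 (F s) (height k s + p%:~R))).
      by apply: (iter_degree1 _ _).1 => //; exact: (family_degree1 Hfam).
    by rewrite (iter_height_shift Hfam)// lerD2r.
  - rewrite iterD intrD addrA; apply: (@le_trans _ _ (iter (w k).1.1 (F t) (height k t + p%:~R))).
      by rewrite (iter_height_shift Hfam)// lerD2r.
    by apply: (iter_degree1 _ _).1 => //; exact: (family_degree1 Hfam).
rewrite gi in n3 n4.
exists n, p; split; first exact: leq_trans n1.
- by apply: rotation_number_le n3; exact: (family_degree1 Hfam).
- by apply: rotation_number_ge n4; exact: (family_degree1 Hfam).
rewrite le_max; apply/orP; right; apply: le_trans KN.
rewrite ler_pM2l ?subr_gt0//.
have lnlam : 0 < ln lam by rewrite ln_gt0.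
have -> : lam ^+ N = expR (ln lam * N%:R).
  by rewrite mulrC expRM_natl lnK// posrE; lra.
rewrite ler_expR mulrAC -mulrA ler_pM2l// ler_pdivrMr// -natrM ler_nat.
by rewrite (leq_trans n2)// mulnC leq_mul2l im orbT.
Qed.

(** One of the parts of [[s, t]] on either side of [y] has at least half its length. By monotonicity
    the fraction found for that part serves [[s, t]], at the price of a factor 2. *)
Lemma rational_between_cat x y z : x \in J -> y \in J -> z \in J ->
  x <= y -> y <= z ->
  rational_between rho x y -> rational_between rho y z -> rational_between rho x z.
Proof.
move=> xJ yJ zJ xy yz [c1 [K1 [c10 K10 H1]]] [c2 [K2 [c20 K20 H2]]].
have mono := rotation_number_nondecreasing Hfam.
exists (Num.min c1 c2), (2 * (K1 + K2)); split; [by rewrite lt_min c10|lra|].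
move=> s t xs st tz.
have [sJ tJ] : s \in J /\ t \in J by move: xJ zJ; rewrite !in_itv /=; lra.
have expc n c : Num.min c1 c2 <= c ->
    expR (Num.min c1 c2 * n%:R) <= expR (c * n%:R) by rewrite ler_expR => ?; exact: ler_wpM2r.
have bound (n : nat) c K d : 0 <= d -> Num.min c1 c2 <= c -> t - s <= 2 * d ->
    d * expR (c * n%:R) <= K -> K <= K1 + K2 ->
    (t - s) * expR (Num.min c1 c2 * n%:R) <= 2 * (K1 + K2).
  move=> d0 hc tsd dK KK.
  have := ler_pM (_ : 0 <= t - s) (expR_ge0 _) tsd (expc n c hc).
  by rewrite -mulrA; lra.
have [sy|ys] := ltP (2 * (t - y)) (t - s).
  have [|||n [p [n0 h1 h2 h3]]] := H1 s (Num.min t y) => //.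
  - by rewrite lt_min; lra.
  - by rewrite ge_min lexx orbT.
  exists n, p; split=> //.
    apply: le_trans h2 _; apply: ler_wpM2l => //; apply: mono => //.
      by rewrite in_itv /= le_min ge_min; move: yJ tJ; rewrite !in_itv /=; lra.
    by rewrite ge_min lexx.
  apply: (bound n c1 K1 (Num.min t y - s)) => //; last by lra.
  - by rewrite subr_ge0 le_min; lra.
  - by rewrite ge_min lexx.
  - by have [?|?] := leP t y; lra.
have [|||n [p [n0 h1 h2 h3]]] := H2 (Num.max s y) t => //.
- by rewrite le_max lexx orbT.
- by rewrite gt_max; lra.
exists n, p; split=> //.
  apply: le_trans h1; apply: ler_wpM2l => //; apply: mono => //.
    by rewrite in_itv /= le_max ge_max; move: yJ sJ; rewrite !in_itv /=; lra.
  by rewrite le_max lexx.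
apply: (bound n c2 K2 (t - Num.max s y)) => //; last by lra.
- by rewrite subr_ge0 ge_max; lra.
- by rewrite ge_min lexx orbT.
- by have [?|?] := leP s y; lra.
Qed.

(** Continuous induction on the right end glues the local estimates; at [smin] the estimate is
    vacuous. *)
Lemma rational_between_family : rational_between rho smin smax.
Proof.
have ss := mf_params Hfam.
apply: (real_induction (a := smin) (b := smax) (P := fun x => rational_between rho smin x)) => //.
- exact: ltW.
- by exists 1, 1; split=> // s t h1 h2 h3; exfalso; lra.
- move=> x xJ Qx.
  have xJ' : x \in J by rewrite in_itv /=; lra.
  have [d d0 H] := rational_between_local xJ'.
  exists (x + d / 2) => [|z zx zb]; first by lra.
  have zJ : z \in J by rewrite in_itv /=; lra.
  apply: (rational_between_cat (y := x)) => //; try by [rewrite in_itv /=; lra|lra].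
  by apply: H => //; rewrite ltr_norml; lra.
- move=> x xJ Qx.
  have xJ' : x \in J by rewrite in_itv /=; lra.
  have [d d0 H] := rational_between_local xJ'.
  pose z := Num.max smin (x - d / 2).
  have [z1 z2 z3] : [/\ smin <= z, x - d / 2 <= z & z < x].
    by rewrite /z le_max lexx le_max lexx orbT gt_max; split => //; lra.
  have zJ : z \in J by rewrite in_itv /=; lra.
  apply: (rational_between_cat (y := z)) => //; try by [rewrite in_itv /=; lra|lra].
    by apply: Qx; rewrite z1.
  by apply: H => //; rewrite ltr_norml; lra.
Qed.

End RationalBetween.

(** * Closures, irrationals, gaps between fractions, and steepness *)

Section RealSets.
Variable R : realType.
Implicit Types (A : set R) (x y e : R).

Lemma closure_distP A x :
  closure A x <-> forall e, 0 < e -> exists2 y, A y & `|y - x| < e.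
Proof.
split=> [clx e e0|H B [e /= e0 eB]].
  have [y [Ay yx]] := clx _ (nbhsx_ballx x e e0).
  by exists y => //; rewrite distrC.
have [y Ay yx] := H e e0; exists y; split=> //; apply: eB.
by rewrite /= distrC.
Qed.

Lemma limit_point_distP A x : limit_point A x <->
  forall e, 0 < e -> exists y, [/\ y != x, A y & `|y - x| < e].
Proof.
split=> [lx e e0|H B [e /= e0 eB]].
  have [y [ynx Ay yx]] := lx _ (nbhsx_ballx x e e0).
  by exists y; split=> //; rewrite distrC.
have [y [ynx Ay yx]] := H e e0; exists y; split=> //; apply: eB.
by rewrite /= distrC.
Qed.

(** The irrationals are a countable intersection of dense open sets, so Baire's theorem makes them
    dense. *)
Lemma irrational_between x y : x < y -> exists2 z : R, irrational z & x < z < y.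
Proof.
move=> xy; have [B oB irrE] := @irrational_Gdelta R.
have := Baire oB; rewrite -irrE => /(_ `]x, y[%classic).
have xy0 : `]x, y[%classic !=set0.
  by exists ((x + y) / 2); rewrite /= in_itv /=; lra.
move=> /(_ xy0 (itv_open _ _))[z [zxy iz]]; by exists z.
Qed.

Lemma fraction_rational (n : nat) (p : int) x : (0 < n)%N -> n%:R * x = p%:~R ->
  rational x.
Proof.
move=> n0 nx; apply/rationalP; exists p, n; rewrite -nx mulrC mulKf//.
by rewrite pnatr_eq0 -lt0n.
Qed.

Lemma rational_fraction (x : R) : rational x ->
  exists n (p : int), (0 < n)%N /\ n%:R * x = p%:~R.
Proof.
move=> [q _ <-]; have [p d _] := ratP q.
exists d.+1, p; split=> //.
by rewrite fmorph_div /= ratr_nat ratr_int mulrC divfK// pnatr_eq0.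
Qed.

(* Two different fractions with denominators n and N are at least 1/(n N) apart. *)
Lemma fraction_gap (n N : nat) (p P : int) (x : R) : (0 < N)%N ->
  N%:R * x = P%:~R -> n%:R * x != p%:~R -> 1 <= N%:R * `|p%:~R - n%:R * x|.
Proof.
move=> N0 NxP nxp; have N0R : (0 : R) < N%:R by rewrite ltr0n.
have NE : N%:R * (p%:~R - n%:R * x) = (N%:Z * p - n%:Z * P)%:~R.
  by rewrite intrB !intrM -!pmulrn -NxP; ring.
rewrite -[X in X * _]gtr0_norm// -normrM NE -intr_norm ler1z -gtz0_ge1 normr_gt0.
rewrite -(intr_eq0 R) -NE mulf_eq0 gt_eqF//= subr_eq0 eq_sym //.
Qed.

Lemma expR_ge_powX x n : 0 <= x -> x ^+ n / n`!%:R <= expR x.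
Proof.
move=> x0; case: n => [|n].
  by rewrite expr0 fact0 divr1; apply: le_trans (expR_ge1Dx x); rewrite lerDl.
by apply: le_trans (expR_ge1Dxn n x0); rewrite lerDr.
Qed.

(** Giving up half of the exponent removes the constant: the square of [ds * expR (c / 2 / D ds)] is
    at most [ds * K], which tends to 0. Comparing [expR] with its [n]-th Taylor term then gives the
    powers. *)
Lemma steep_littleo (D : R -> R) (c K d0 : R) : 0 < c -> 0 < K -> 0 < d0 ->
  (forall ds, 0 < ds < d0 -> 0 < D ds /\ ds * expR (c / D ds) <= K) ->
  (exists c d : R, [/\ 0 < c, 0 < d &
    forall ds, 0 < ds < d -> ds < expR (- (c / D ds))]) /\
  (forall n, (fun ds => ds) =o_ (0^'+) (fun ds => D ds ^+ n)).
Proof.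
move=> c0 K0 d00 H.
have half ds : 0 < ds < d0 ->
    (ds * expR (c / 2 / D ds)) ^+ 2 <= ds * K /\ 0 <= c / 2 / D ds.
  move=> hds; have [D0 DK] := H ds hds; split; last by rewrite !divr_ge0// ltW.
  rewrite exprMn -expRM_natl (_ : _ * (c / 2 / D ds) = c / D ds).
    by rewrite expr2 -mulrA ler_pM2l//; lra.
  by rewrite (mulrC 2) -!mulrA (mulrCA 2^-1) mulVf// mulr1.
split.
  exists (c / 2), (Num.min d0 K^-1); split; [by rewrite divr_gt0|by rewrite lt_min d00 invr_gt0|].
  move=> ds; rewrite lt_min => /andP[ds0 /andP[ds1 dsK]].
  have [|hsq _] := half ds; first by rewrite ds0.
  rewrite expRN -[ltRHS]mul1r ltr_pdivlMr ?expR_gt0//.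
  have dsE : 0 <= ds * expR (c / 2 / D ds) by rewrite mulr_ge0 ?expR_ge0// ltW.
  rewrite -(@ltr_pXn2r _ 2) ?nnegrE//.
  rewrite expr1n; apply: le_lt_trans hsq _.
  by rewrite -ltr_pdivlMr// div1r.
move=> n; apply/eqoP => e e0.
(* The Taylor term [(c / 2 / D ds) ^+ n / n!] equals [1 / (M * D ds ^+ n)]. *)
pose M := n`!%:R * (2 / c) ^+ n.
have M0 : 0 < M by rewrite mulr_gt0 ?ltr0n ?fact_gt0// exprn_gt0// divr_gt0.
near=> ds.
have ds0 : 0 < ds by near: ds; exact: nbhs_right_gt.
have dsd : ds < d0 by near: ds; exact: nbhs_right_lt.
have dse : ds < (e / M) ^+ 2 / K.
  by near: ds; apply: nbhs_right_lt; rewrite divr_gt0// exprn_gt0// divr_gt0.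
have hds : 0 < ds < d0 by rewrite ds0.
have [D0 _] := H ds hds; have [hsq x0] := half ds hds.
rewrite !gtr0_norm ?exprn_gt0//.
set E := expR _ in hsq.
have E0 : 0 < E by exact: expR_gt0.
have h1 : ds * E <= e / M.
  have dsE : 0 <= ds * E by rewrite mulr_ge0// ltW.
  have eM : 0 <= e / M by rewrite divr_ge0// ltW.
  rewrite -(@ler_pXn2r _ 2) ?nnegrE//.
  by apply: le_trans hsq _; rewrite -ler_pdivlMr// ltW.
have h2 : (c / 2 / D ds) ^+ n / n`!%:R <= E by exact: expR_ge_powX.
have h3 : 1 <= M * (D ds ^+ n) * E.
  have MD : 0 < M * D ds ^+ n by rewrite mulr_gt0// exprn_gt0.
  rewrite -ler_pdivrMl// mulr1; apply: le_trans h2.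
  have cn : c ^+ n != 0 by rewrite expf_neq0// gt_eqF.
  have Dn : D ds ^+ n != 0 by rewrite expf_neq0// gt_eqF.
  have fn : n`!%:R != 0 :> R by rewrite pnatr_eq0 -lt0n fact_gt0.
  have tn : (2 : R) ^+ n != 0 by rewrite expf_neq0// pnatr_eq0.
  rewrite /M !expr_div_n le_eqVlt; apply/orP; left; apply/eqP; field.
  by rewrite cn Dn fn tn.
rewrite -(ler_pM2r E0); apply: le_trans h1 _.
rewrite ler_pdivrMr//.
by have := ler_wpM2l (ltW e0) h3; rewrite mulr1; lra.
Unshelve. all: by end_near. Qed.

End RealSets.

(** * Level sets, irrational parameters and steepness, from the fraction estimate *)

Section PlateauStructure.
Variables (R : realType) (smin smax : R) (rho : R -> R).
Local Notation J := `[smin, smax].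
Hypothesis ltsmin : smin < smax.
Hypothesis rho_mono : {in J &, {homo rho : s t / s <= t}}.
Hypothesis rho_cont : {within [set` J], continuous rho}.
Hypothesis rho_between : rational_between rho smin smax.
Hypothesis rho_plateau : forall s, s \in `]smin, smax[ -> rational (rho s) ->
  exists t, [/\ t \in J, t != s & rho t = rho s].
Local Notation C := (irrational_params smin smax rho).

Lemma fraction_between s t : s \in J -> t \in J -> s < t ->
  exists n (p : int), [/\ (0 < n)%N, n%:R * rho s <= p%:~R & p%:~R <= n%:R * rho t].
Proof.
move=> sJ tJ st; have [c [K [c0 K0 H]]] := rho_between.
have [||n [p [n0 h1 h2 _]]] := H s t _ st.
- by move: sJ; rewrite in_itv => /andP[].
- by move: tJ; rewrite in_itv => /andP[].
by exists n, p.
Qed.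

(** If the two values agreed, the fraction between them would equal both. *)
Lemma irrational_strict s t : s \in J -> t \in J -> s < t ->
  irrational (rho s) \/ irrational (rho t) -> rho s < rho t.
Proof.
move=> sJ tJ st irr; rewrite lt_neqAle rho_mono ?(ltW st)// andbT.
apply/eqP => est; have [n [p [n0 h1 h2]]] := fraction_between sJ tJ st.
have np : n%:R * rho s = p%:~R by apply/le_anti; rewrite h1 est h2.
have := fraction_rational n0 np.
by case: irr => [|+ rs]; [|rewrite -est in rs *]; apply.
Qed.

Lemma intermediate_param s t v : s \in J -> t \in J -> s <= t ->
  rho s <= v <= rho t -> exists2 u, s <= u <= t & rho u = v.
Proof.
move=> sJ tJ st vst; have [||u] := @IVT R rho s t v st.
- apply: continuous_subspaceW rho_cont => x /=.
  by move: sJ tJ; rewrite !in_itv /=; lra.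
- by rewrite min_l ?max_r// rho_mono.
by rewrite in_itv /= => ust <-; exists u.
Qed.

Lemma level_set_itv r : level_set smin smax rho r !=set0 ->
  exists al be, level_set smin smax rho r = [set` `[al, be]] /\ al <= be.
Proof.
set L := level_set _ _ _ _; move=> [s0 [s0J rs0]].
have L0 : L !=set0 by exists s0.
(* The level set is closed, so it contains its infimum and supremum; monotonicity then fills in
   everything between. *)
have Ladh s : (forall e, 0 < e -> exists2 t, L t & `|t - s| < e) -> L s.
  move=> H; have sJ : s \in J.
    rewrite in_itv /=; apply/andP; split; rewrite leNgt; apply/negP => ss.
      have [|t [+ _]] := H (smin - s); first lra.
      by rewrite in_itv /= ltr_norml; lra.
    have [|t [+ _]] := H (s - smax); first lra.
    by rewrite in_itv /= ltr_norml; lra.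
  split=> //; apply/eqP; rewrite -subr_eq0 -normr_le0 leNgt; apply/negP => e0.
  have [d d0 Hd] := (within_continuous_distP _ _).1 rho_cont s sJ _ e0.
  have [t [tJ rt] ts] := H d d0.
  by have := Hd t tJ ts; rewrite rt distrC ltxx.
have hs : has_sup L.
  by split=> //; exists smax => x [+ _]; rewrite in_itv => /andP[].
have hi : has_inf L.
  by split=> //; exists smin => x [+ _]; rewrite in_itv => /andP[].
have Linf : L (inf L).
  apply: Ladh => e e0; have [x Lx xe] := inf_adherent e0 hi.
  exists x => //; have := ge_inf hi.2 Lx; rewrite ltr_norml; lra.
have Lsup : L (sup L).
  apply: Ladh => e e0; have [x Lx xe] := sup_adherent e0 hs.
  exists x => //; have := ub_le_sup hs.2 Lx; rewrite ltr_norml; lra.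
exists (inf L), (sup L); split; last first.
  exact: le_trans (ge_inf hi.2 (conj s0J rs0)) (ub_le_sup hs.2 (conj s0J rs0)).
apply/seteqP; split=> s /=.
  by move=> Ls; rewrite in_itv /= (ge_inf hi.2 Ls) (ub_le_sup hs.2 Ls).
rewrite in_itv /= => /andP[s1 s2]; have [i1 i2] := Linf; have [u1 u2] := Lsup.
have sJ : s \in J by move: i1 u1; rewrite !in_itv /=; lra.
split=> //; apply/le_anti; rewrite -{1}u2 -i2.
by rewrite !rho_mono.
Qed.

(** An interior parameter shares its rational level with another one, so only a level cut off by an
    end of [J] can degenerate to a point. *)
Lemma rational_level_set_itv r : rational r -> level_set smin smax rho r !=set0 ->
  exists al be, [/\ level_set smin smax rho r = [set` `[al, be]], al <= be &
    al = be -> al = smin \/ al = smax].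
Proof.
move=> ratr /level_set_itv[al [be [LE ab]]]; exists al, be; split=> // eab.
have [alJ ral] : level_set smin smax rho r al.
  by rewrite LE /= in_itv /= lexx.
apply: contrapT => /not_orP[al1 al2].
have [||t [tJ tal rt]] := rho_plateau (s := al).
- rewrite in_itv /= !lt_neqAle; move: alJ; rewrite in_itv /= => /andP[-> ->].
  by rewrite !andbT eq_sym; apply/andP; split; apply/eqP.
- by rewrite ral.
have : level_set smin smax rho r t by split=> //; rewrite rt.
rewrite LE -eab /= in_itv /= => /le_anti; move/eqP: tal => + alt.
by rewrite -alt.
Qed.

Lemma irrational_level_set_point r : irrational r ->
  level_set smin smax rho r !=set0 -> exists s, level_set smin smax rho r = [set s].
Proof.
move=> ir [s [sJ rs]]; exists s; apply/seteqP; split=> [t [tJ rt]|_ ->] //=.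
have [st|ts|//] := ltgtP s t.
  by have := irrational_strict sJ tJ st; rewrite rs rt ltxx => /(_ (or_introl ir)).
by have := irrational_strict tJ sJ ts; rewrite rs rt ltxx => /(_ (or_introl ir)).
Qed.

Lemma closure_irrational_params s : closure C s -> s \in J.
Proof.
move=> /closure_distP cs; rewrite in_itv /=; apply/andP; split; rewrite leNgt;
  apply/negP => ss.
  have [|t [+ _]] := cs (smin - s); first lra.
  by rewrite in_itv /= ltr_norml; lra.
have [|t [+ _]] := cs (s - smax); first lra.
by rewrite in_itv /= ltr_norml; lra.
Qed.

Lemma closure_irrational_params_plateau r al be s : rational r ->
  level_set smin smax rho r = [set` `[al, be]] -> al < s < be -> ~ closure C s.
Proof.
move=> ratr LE sab /closure_distP /(_ (Num.min (s - al) (be - s))).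
case; first by rewrite lt_min; lra.
move=> t [tJ it]; rewrite lt_min !ltr_norml => tab.
have : level_set smin smax rho r t by rewrite LE /= in_itv /=; lra.
by move=> [_ rt]; apply: it; rewrite rt.
Qed.

(** An interval inside the closure would contain two points of [C]. A fraction between their levels
    has its whole plateau between them, and the inside of that plateau misses the closure. *)
Lemma irrational_params_nowhere_dense : nowhere_dense C.
Proof.
apply/seteqP; split=> // x [e /= e0 xC].
have inC y : x - e < y < x + e -> closure C y.
  by move=> yx; apply: xC; rewrite /= ltr_norml; lra.
have dense u v : x - e <= u -> u < v -> v <= x + e -> exists2 y, C y & u < y < v.
  move=> xu uv vx; have [||y Cy yuv] := (closure_distP C ((u + v) / 2)).1 _ ((v - u) / 2).
  - by apply: inC; lra.
  - lra.
  by exists y => //; move: yuv; rewrite ltr_norml; lra.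
have [|||y [yJ iy] yx] := dense (x - e) (x + e); try lra.
have [|||z [zJ iz] zx] := dense y (x + e); try lra.
have yz : y < z by lra.
have [n [p [n0 h1 h2]]] := fraction_between yJ zJ yz.
have n0R : (0 : R) < n%:R by rewrite ltr0n.
pose q : R := p%:~R / n%:R.
have nq : n%:R * q = p%:~R by rewrite mulrC divfK ?gt_eqF.
have ratq : rational q by exact: fraction_rational nq.
have [|w wyz rw] := intermediate_param (v := q) yJ zJ (ltW yz).
  by rewrite -(ler_pM2l n0R) nq h1 -(ler_pM2l n0R) nq h2.
have wJ : w \in J by move: yJ zJ; rewrite !in_itv /=; lra.
have [|al [be [LE ab abe]]] := rational_level_set_itv ratq; first by exists w.
have wab : al <= w <= be.
  have : level_set smin smax rho q w by [].
  by rewrite LE /= in_itv.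
have yal : y < al.
  rewrite ltNge; apply/negP => aly.
  have : level_set smin smax rho q y by rewrite LE /= in_itv /=; lra.
  by move=> [_ ry]; apply: iy; rewrite ry.
have bez : be < z.
  rewrite ltNge; apply/negP => aly.
  have : level_set smin smax rho q z by rewrite LE /= in_itv /=; lra.
  by move=> [_ rz]; apply: iz; rewrite rz.
(* The plateau lies strictly between [y] and [z], hence away from [smin] and [smax], so it cannot
   degenerate. *)
have altbe : al < be.
  rewrite lt_neqAle ab andbT; apply/eqP => /abe.
  by move: yJ zJ; rewrite !in_itv /=; lra.
apply: (closure_irrational_params_plateau ratq LE (s := (al + be) / 2)); first by lra.
by apply: inC; lra.
Qed.

(** Since [rho] is strictly monotone at an irrational level, arbitrarily close to [s] there is an
    irrational value strictly between two values of [rho], and the intermediate value theorem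
    attains it. *)
Lemma irrational_params_limit s : C s -> limit_point C s.
Proof.
move=> [sJ is_]; apply/limit_point_distP => e e0.
have near u v : u \in J -> v \in J -> u < v -> u = s \/ v = s ->
    exists2 t, C t & u < t < v.
  move=> uJ vJ uv us.
  have /irrational_between[w iw wuv] : rho u < rho v.
    by apply: irrational_strict => //; case: us => ->; [left|right].
  have [|t tuv rt] := intermediate_param (v := w) uJ vJ (ltW uv).
    by move: wuv => /andP[/ltW -> /ltW ->].
  have tu : t != u by apply: contraTneq wuv => tu; rewrite -rt tu ltxx.
  have tv : t != v by apply: contraTneq wuv => tv; rewrite -rt tv ltxx andbF.
  exists t.
    by split; [move: uJ vJ; rewrite !in_itv /=; lra|rewrite rt].
  by move: tuv; rewrite !le_eqVlt (eq_sym u) (negbTE tu) (negbTE tv).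
have [ss|ss] := ltP s smax.
  have [||||t Ct tst] := near s (Num.min smax (s + e)) => //.
  - by move: sJ; rewrite !in_itv /= le_min ge_min; lra.
  - by rewrite lt_min; lra.
  - by left.
  move: tst; rewrite lt_min => tst.
  by exists t; split=> //; [rewrite gt_eqF//; lra|rewrite ltr_norml; lra].
have [||||t Ct tst] := near (Num.max smin (s - e)) s => //.
- by move: sJ; rewrite !in_itv /= le_max ge_max; lra.
- by rewrite gt_max; have := ltsmin; lra.
- by right.
move: tst; rewrite gt_max => tst.
by exists t; split=> //; [rewrite lt_eqF//; lra|rewrite ltr_norml; lra].
Qed.

Lemma closure_irrational_params_perfect : perfect_set (closure C).
Proof.
split; first exact: closed_closure.
apply/seteqP; split=> x; rewrite ?closure_distP ?limit_point_distP.
  move=> H e e0; have [|y [_ /closure_distP cy yx]] := H (e / 2); first by lra.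
  have [|z Cz zy] := cy (e / 2); first by lra.
  by exists z => //; move: yx zy; rewrite !ltr_norml; lra.
have [Cx _ e e0|nCx H e e0] := EM (C x).
  have /limit_point_distP/(_ e e0)[y [yx Cy ye]] := irrational_params_limit Cx.
  by exists y; split=> //; exact: subset_closure.
have [y Cy yx] := H e e0; exists y; split=> //; last exact: subset_closure.
by apply: contra_notN nCx => /eqP <-.
Qed.

(** This tells what passing to the perfect set [closure C] adds to [C]: inner points of plateaus
    stay away from [C], so only ends remain. *)
Lemma closure_irrational_params_endpoint s : closure C s -> ~ C s ->
  exists r : rat, left_endpoint (plateau smin smax rho r) s \/
                  right_endpoint (plateau smin smax rho r) s.
Proof.
move=> cs nCs; have sJ := closure_irrational_params cs.
have : rational (rho s) by apply: contrapT => irr; apply: nCs.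
move=> [r _ rs].
have Ls : level_set smin smax rho (ratr r) s by [].
have ratR : rational (ratr r : R) by exists r.
have [|al [be [LE ab _]]] := rational_level_set_itv ratR; first by exists s.
exists r; rewrite /left_endpoint /right_endpoint /plateau.
have sab : al <= s <= be by move: Ls; rewrite LE /= in_itv.
have [als|als] := ltP al s; last first.
  by left; split=> // t; rewrite LE /= in_itv /=; lra.
have [sbe|sbe] := ltP s be; last first.
  by right; split=> // t; rewrite LE /= in_itv /=; lra.
by case: (closure_irrational_params_plateau ratR LE (s := s)) => //; rewrite als.
Qed.

(** By [fraction_gap], a fraction with denominator [n] other than [P / N] lies at distance at least
    [1 / (n N)] from it. Distance at most [y] thus forces [n >= 1 / (N y)]. *)
Lemma steep_bound s0 s t (N : nat) (P : int) c K y :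
  (0 < N)%N -> N%:R * rho s0 = P%:~R -> 0 < c -> 0 < y ->
  (exists n (p : int), [/\ (0 < n)%N, n%:R * rho s0 != p%:~R,
    `|p%:~R - n%:R * rho s0| <= n%:R * y & (t - s) * expR (c * n%:R) <= K]) ->
  s < t -> (t - s) * expR (c / N%:R / y) <= K.
Proof.
move=> N0 NP c0 y0 [n [p [n0 np ny hK]]] st.
have N0R : (0 : R) < N%:R by rewrite ltr0n.
apply: le_trans hK; rewrite ler_pM2l ?subr_gt0// ler_expR.
have gap : 1 <= N%:R * (n%:R * y).
  by apply: le_trans (fraction_gap N0 NP np) _; rewrite ler_pM2l.
rewrite !ler_pdivrMr//.
by have := ler_wpM2l (ltW c0) gap; rewrite mulr1; lra.
Qed.

Lemma steep_right s0 : s0 \in J -> s0 < smax -> rational (rho s0) ->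
  (forall t, t \in J -> s0 < t -> rho t != rho s0) ->
  (exists c delta : R, [/\ 0 < c, 0 < delta &
     forall ds : R, 0 < ds < delta ->
       ds < expR (- (c / (rho (s0 + ds) - rho s0)))]) /\
  (forall n : nat, (fun ds : R => ds) =o_ (0^'+)
     (fun ds : R => (rho (s0 + ds) - rho s0) ^+ n)).
Proof.
move=> s0J s0max /rational_fraction[N [P [N0 NP]]] neq.
have [c [K [c0 K0 H]]] := rho_between.
have N0R : (0 : R) < N%:R by rewrite ltr0n.
have rho_gt t : t \in J -> s0 < t -> rho s0 < rho t.
  by move=> tJ st; rewrite lt_neqAle eq_sym neq// rho_mono// ltW.
apply: (steep_littleo (c := c / N%:R) (K := 2 * K) (d0 := smax - s0)).
- by rewrite divr_gt0.
- by rewrite mulr_gt0.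
- by rewrite subr_gt0.
(* Starting from the midpoint keeps the fraction strictly above [rho s0]; it costs the factor 2 in
   the constant. *)
move=> ds dsd; pose s := s0 + ds / 2.
have [sJ tJ] : s \in J /\ s0 + ds \in J.
  by move: s0J; rewrite /s !in_itv /=; lra.
have D0 : 0 < rho (s0 + ds) - rho s0 by rewrite subr_gt0 rho_gt//; lra.
split=> //.
have [|||n [p [n0 h1 h2 h3]]] := H s (s0 + ds); try by move: s0J; rewrite /s !in_itv /=; lra.
have n0R : (0 : R) < n%:R by rewrite ltr0n.
have sp : n%:R * rho s0 < p%:~R.
  by apply: lt_le_trans h1; rewrite ltr_pM2l// rho_gt// /s; lra.
suff : (s0 + ds - s) * expR (c / N%:R / (rho (s0 + ds) - rho s0)) <= K.
  by rewrite (_ : s0 + ds - s = ds / 2); [lra|rewrite /s; lra].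
apply: (steep_bound N0 NP c0 D0); last by rewrite /s; lra.
by exists n, p; split=> //; rewrite ?lt_eqF// gtr0_norm; lra.
Qed.

Lemma steep_left s0 : s0 \in J -> smin < s0 -> rational (rho s0) ->
  (forall t, t \in J -> t < s0 -> rho t != rho s0) ->
  (exists c delta : R, [/\ 0 < c, 0 < delta &
     forall ds : R, 0 < ds < delta ->
       ds < expR (- (c / (rho s0 - rho (s0 - ds))))]) /\
  (forall n : nat, (fun ds : R => ds) =o_ (0^'+)
     (fun ds : R => (rho s0 - rho (s0 - ds)) ^+ n)).
Proof.
move=> s0J s0min /rational_fraction[N [P [N0 NP]]] neq.
have [c [K [c0 K0 H]]] := rho_between.
have N0R : (0 : R) < N%:R by rewrite ltr0n.
have rho_lt t : t \in J -> t < s0 -> rho t < rho s0.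
  by move=> tJ st; rewrite lt_neqAle neq// rho_mono// ltW.
apply: (steep_littleo (c := c / N%:R) (K := 2 * K) (d0 := s0 - smin)).
- by rewrite divr_gt0.
- by rewrite mulr_gt0.
- by rewrite subr_gt0.
move=> ds dsd; pose t := s0 - ds / 2.
have [tJ sJ] : t \in J /\ s0 - ds \in J.
  by move: s0J; rewrite /t !in_itv /=; lra.
have D0 : 0 < rho s0 - rho (s0 - ds) by rewrite subr_gt0 rho_lt//; lra.
split=> //.
have [|||n [p [n0 h1 h2 h3]]] := H (s0 - ds) t; try by move: s0J; rewrite /t !in_itv /=; lra.
have n0R : (0 : R) < n%:R by rewrite ltr0n.
have sp : p%:~R < n%:R * rho s0.
  by apply: le_lt_trans h2 _; rewrite ltr_pM2l// rho_lt// /t; lra.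
suff : (t - (s0 - ds)) * expR (c / N%:R / (rho s0 - rho (s0 - ds))) <= K.
  by rewrite (_ : t - (s0 - ds) = ds / 2); [lra|rewrite /t; lra].
apply: (steep_bound N0 NP c0 D0); last by rewrite /t; lra.
by exists n, p; split=> //; rewrite ?gt_eqF// ltr0_norm; lra.
Qed.

(** Group the parameters by the number of fractions with denominator at most [N] below [rho]. Two
    parameters of one class have no such fraction between their levels, so the fraction between them
    has a larger denominator and they are close. *)
Lemma irrational_params_cover : exists c K B : R, [/\ 0 < c, 0 < K, 0 < B &
  forall N : nat, exists k (U : nat -> set R), [/\ C `<=` \bigcup_i U i,
    k%:R <= B * N.+1%:R ^+ 2, forall i, (k <= i)%N -> U i = set0 &
    forall i x y, U i x -> U i y -> `|x - y| * expR (c * N%:R) <= K]].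
Proof.
have [c [K [c0 K0 H]]] := rho_between.
pose M := Num.bound (`|rho smin| + `|rho smax|).
have rhoM s : s \in J -> - M%:R <= rho s <= M%:R.
  move=> sJ; have := unstable.ltr_bound (`|rho smin| + `|rho smax|).
  rewrite -/M; have := ler_norm (- rho smin); rewrite normrN.
  have := ler_norm (rho smax); have := normr_ge0 (rho smin); have := normr_ge0 (rho smax).
  have [sminJ smaxJ] : smin \in J /\ smax \in J by rewrite !in_itv /= !lexx ltW.
  have := rho_mono sminJ sJ; have := rho_mono sJ smaxJ.
  by move: sJ; rewrite in_itv /= => /andP[-> ->] /(_ isT) + /(_ isT); lra.
(* There will be [(N + 1) * (2 M N + 1) + 1] classes, which is at most [(2 M + 2) * (N + 1) ^ 2]. *)
exists c, K, (2 * M%:R + 2); split=> // N.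
(* The fractions of denominator n <= N are (i - M n) / n; those below rho s are
   counted without dividing. *)
pose T := ('I_N.+1 * 'I_(2 * M * N).+1)%type.
pose below s : {set T} :=
  finset (fun x : T => (x.2 : nat)%:R < (x.1 : nat)%:R * (rho s + M%:R)).
have below_mono s t : s \in J -> t \in J -> s <= t -> below s \subset below t.
  move=> sJ tJ st; apply/fintype.subsetP => x; rewrite !inE => /lt_le_trans; apply.
  by apply: ler_wpM2l => //; rewrite lerD2r rho_mono.
have below_lt s t : C s -> C t -> s < t -> #|below s| = #|below t| ->
    (t - s) * expR (c * N%:R) <= K.
  move=> [sJ irs] [tJ irt] st cst.
  have [||n [p [n0 h1 h2 h3]]] := H s t _ st _.
  - by move: sJ; rewrite in_itv => /andP[].
  - by move: tJ; rewrite in_itv => /andP[].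
  apply: le_trans h3; rewrite ler_pM2l ?subr_gt0// ler_expR ler_pM2l// ler_nat.
  rewrite leqNgt; apply/negP => nN.
  have n0R : (0 : R) < n%:R by rewrite ltr0n.
  have eq_below : below s = below t.
    by apply/eqP; rewrite eqEcard below_mono ?(ltW st)//= cst.
  have pM : - (n%:R * M%:R) <= (p%:~R : R) <= n%:R * M%:R.
    have /andP[s1 _] := rhoM s sJ; have /andP[_ t2] := rhoM t tJ.
    by have := ler_wpM2l (ltW n0R) s1; have := ler_wpM2l (ltW n0R) t2; lra.
  pose q := (p + (n * M)%N%:Z)%R.
  have qE : (q%:~R : R) = p%:~R + n%:R * M%:R by rewrite intrD -natrM.
  have [i qi] : exists i : nat, q = i%:Z.
    have : (0 : R) <= q%:~R by rewrite qE; lra.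
    by rewrite ler0z; case: (q) => // i _; exists i.
  have iE : (i%:R : R) = p%:~R + n%:R * M%:R by rewrite -qE qi.
  have iN : (i < (2 * M * N).+1)%N.
    rewrite ltnS -(ler_nat R) iE !natrM.
    have : (n%:R : R) <= N%:R by rewrite ler_nat ltnW.
    move=> /(ler_wpM2l (ler0n R M)); lra.
  (* The fraction [p / n] lies below [rho t], strictly because [rho t] is irrational, but not below
     [rho s]; this contradicts [eq_below]. *)
  have : (Ordinal (leqW nN), Ordinal iN) \in below t.
    rewrite inE /= iE mulrDr ltrD2r lt_neqAle h2 andbT.
    by apply/eqP => pE; apply: irt; exact: fraction_rational n0 (esym pE).
  by rewrite -eq_below inE /= iE mulrDr ltrD2r ltNge h1.
exists #|{: T}|.+1, (fun i => [set s | C s /\ #|below s| = i]); split.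
- by move=> s Cs; exists #|below s|.
- rewrite card_prod !card_ord -natr1 natrM -[(2 * M * N).+1%:R]natr1 !natrM.
  rewrite -[N.+1%:R]natr1.
  have N0 : (0 : R) <= N%:R by [].
  have M0 : (0 : R) <= M%:R by [].
  have := mulr_ge0 N0 M0; have := mulr_ge0 N0 N0; rewrite expr2; lra.
- move=> i ki; apply/seteqP; split=> // s [_ si]; move: ki.
  by rewrite -si leqNgt ltnS max_card.
- move=> i x y [Cx xi] [Cy yi]; have [xy|yx|->] := ltgtP x y.
  + by rewrite ltr0_norm ?subr_lt0// opprB below_lt// xi.
  + by rewrite gtr0_norm ?subr_gt0// below_lt// xi.
  + by rewrite subrr normr0 mul0r ltW.
Qed.

End PlateauStructure.

(** * Hausdorff dimension zero from exponentially fine covers *)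

Section HausdorffDimension.
Variable R : realType.
Implicit Types (A U : set R) (d r : R).
Local Open Scope ereal_scope.

Lemma hausdorff_weight_ge0 d U : 0 <= hausdorff_weight d U.
Proof. by rewrite /hausdorff_weight; case: ifP => // _; exact: poweR_ge0. Qed.

Lemma diam_le r U : (forall x y, U x -> U y -> `|x - y| <= r)%R -> diam U <= r%:E.
Proof.
by move=> H; apply: ge_ereal_sup => _ [x Ux [y Uy <-]]; rewrite lee_fin H.
Qed.

Lemma hausdorff_weight_le d r U : (0 <= d)%R -> (0 <= r)%R -> diam U <= r%:E ->
  hausdorff_weight d U <= (r `^ d)%:E.
Proof.
move=> d0 r0 Ur; rewrite /hausdorff_weight.
case: ifPn => [_|/set0P[x Ux]]; first by rewrite lee_fin powR_ge0.
rewrite -poweR_EFin gt0_ler_poweR// in_itv /= ?lee_fin ?r0 ?leey//.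
rewrite andbT; apply: ereal_sup_ubound.
by exists x => //; exists x => //; rewrite subrr normr0.
Qed.

Lemma hausdorff_premeasure_ge0 d delta A : 0 <= hausdorff_premeasure d delta A.
Proof.
apply: le_ereal_inf_tmp => _ [U _ <-]; apply: nneseries_ge0 => i _ _.
exact: hausdorff_weight_ge0.
Qed.

Lemma hausdorff_premeasure_le d delta r A (U : nat -> set R) k :
  (0 <= d)%R -> (0 <= r <= delta)%R -> A `<=` \bigcup_i U i ->
  (forall i, (k <= i)%N -> U i = set0) -> (forall i, diam (U i) <= r%:E) ->
  hausdorff_premeasure d delta A <= (k%:R * r `^ d)%:E.
Proof.
move=> d0 /andP[r0 rd] AU U0 dU.
apply: (@le_trans _ _ (\sum_(0 <= i <oo) hausdorff_weight d (U i))).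
  apply: ereal_inf_lbound; exists U => //; split=> // i.
  by apply: le_trans (dU i) _; rewrite lee_fin.
rewrite (nneseries_split _ k)//; last by move=> i _; exact: hausdorff_weight_ge0.
rewrite eseries0 ?adde0; last first.
  by move=> i ki _; rewrite U0// /hausdorff_weight eqxx.
apply: le_trans (_ : \sum_(0 <= i < 0 + k) (r `^ d)%:E <= _).
  by apply: lee_sum => i _; exact: hausdorff_weight_le.
by rewrite sumEFin lee_fin sumr_const_nat subn0 add0n mulr_natl.
Qed.

(** For each [d > 0] the [N]-th cover has weight at most [B (N + 1)^2 K^d exp (- c d N)], which
    tends to 0, so the measure vanishes in every positive dimension. *)
Lemma hausdorff_dim_small_covers A (c K B : R) : (0 < c)%R -> (0 < K)%R -> (0 < B)%R ->
  (forall N : nat, exists k (U : nat -> set R), [/\ A `<=` \bigcup_i U i,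
    (k%:R <= B * N.+1%:R ^+ 2)%R, forall i, (k <= i)%N -> U i = set0 &
    forall i x y, U i x -> U i y -> (`|x - y| * expR (c * N%:R) <= K)%R]) ->
  hausdorff_dim A = 0.
Proof.
move=> c0 K0 B0 H.
have small d delta e : (0 < d)%R -> (0 < delta)%R -> (0 < e)%R ->
    hausdorff_premeasure d delta A <= e%:E.
  move=> d0 delta0 e0.
  (* The factor 24 is 4 times 6: [(N + 1)^2 <= 4 N^2], and the exponential is bounded below by its
     cubic term, with [3! = 6]. Exceeding [L] makes the weight at most [e]; the other summand of [N]
     makes the diameters at most [delta]. *)
  pose L := (24 * B * K `^ d / (c * d) ^+ 3 / e)%R.
  pose N := (Num.bound (K / delta / c) + Num.bound L).+1.
  have cd0 : (0 < (c * d) ^+ 3)%R by rewrite exprn_gt0// mulr_gt0.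
  have N1 : (1 <= N%:R :> R)%R by rewrite ler1n.
  have NK : (K <= delta * (c * N%:R))%R.
    have : (K / delta / c < N%:R)%R.
      apply: lt_le_trans (unstable.ltr_bound _) _.
      by rewrite ler_nat /N leqW// leq_addr.
    by rewrite !ltr_pdivrMr//; lra.
  have NL : (24 * B * K `^ d <= e * (N%:R * (c * d) ^+ 3))%R.
    have : (L < N%:R)%R.
      apply: lt_le_trans (unstable.ltr_bound _) _.
      by rewrite ler_nat /N leqW// leq_addl.
    by rewrite /L !ltr_pdivrMr//; lra.
  have [k [U [AU kB U0 dU]]] := H N.
  pose r := (K * expR (- (c * N%:R)))%R.
  have r0 : (0 <= r)%R by rewrite mulr_ge0 ?expR_ge0// ltW.
  have rdelta : (r <= delta)%R.
    rewrite /r expRN ler_pdivrMr ?expR_gt0//; apply: le_trans NK _.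
    rewrite ler_pM2l//; apply: le_trans (expR_ge1Dx _); lra.
  apply: le_trans (hausdorff_premeasure_le (r := r) (ltW d0) _ AU U0 _) _.
  - by rewrite r0.
  - move=> i; apply: diam_le => x y Ux Uy.
    by rewrite /r expRN ler_pdivlMr ?expR_gt0// (dU i).
  rewrite lee_fin /r powRM ?expR_ge0 ?(ltW K0)// -expRM mulNr expRN.
  rewrite mulrA ler_pdivrMr ?expR_gt0//.
  have Kd0 : (0 <= K `^ d)%R by exact: powR_ge0.
  have cube : ((c * N%:R * d) ^+ 3 / 6 <= expR (c * N%:R * d))%R.
    have -> : (6 : R)%R = 3`!%:R by [].
    by apply: expR_ge_powX; rewrite !mulr_ge0// ltW.
  apply: le_trans (_ : e * ((c * N%:R * d) ^+ 3 / 6) <= _)%R; last by rewrite ler_pM2l.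
  apply: le_trans (ler_wpM2r Kd0 kB) _.
  have NN : (N.+1%:R ^+ 2 <= 4 * N%:R ^+ 2 :> R)%R.
    rewrite -natr1; nra.
  apply: le_trans (_ : 4 * (B * N%:R ^+ 2 * K `^ d) <= _)%R.
    by have := ler_wpM2l (mulr_ge0 (ltW B0) Kd0) NN; lra.
  have := ler_wpM2l (sqr_ge0 (N%:R : R)) NL; lra.
have measure0 d : (0 < d)%R -> hausdorff_measure d A = 0.
  move=> d0; apply/le_anti/andP; split.
    apply: ge_ereal_sup => _ [delta /= delta0 <-].
    by apply/lee_addgt0Pr => e e0; rewrite add0e small.
  apply: le_trans (hausdorff_premeasure_ge0 d 1 A) _.
  by apply: ereal_sup_ubound; exists 1%R => //=; exact: ltr01.
apply/le_anti/andP; split.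
  apply/lee_addgt0Pr => e e0; rewrite add0e.
  by apply: ereal_inf_lbound; exists e => //; split; [exact: ltW|exact: measure0].
by apply: le_ereal_inf_tmp => _ [d [d0 _] <-]; rewrite lee_fin.
Qed.

End HausdorffDimension.

(** * Rational levels at interior parameters *)

Section RationalPlateaus.
Variables (R : realType) (smin smax : R).
Variables (f : R -> circle R -> circle R) (F : R -> R -> R).
Variables (m : nat) (a b : 'I_m -> R -> R).
Hypothesis Hfam : monotone_family smin smax f F a b.
Local Notation J := `[smin, smax].
Local Notation rho := (fun s => rotation_number (F s)).

(* If s were alone at its level p/n, then the n-th iterate would stay above the
   translation by p for larger parameters and below it for smaller ones, so it
   would be this translation at s, which is not constant on the flat spots. *)
Lemma rational_param_not_alone s : s \in `]smin, smax[ -> rational (rho s) ->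
  exists t, [/\ t \in J, t != s & rho t = rho s].
Proof.
rewrite in_itv /= => sI /rational_fraction[n [p [n0 np]]].
apply: contrapT => alone.
have n0R : (0 : R) < n%:R by rewrite ltr0n.
have sJ : s \in J by rewrite in_itv /=; lra.
have neq t : t \in J -> t != s -> rho t != rho s.
  by move=> tJ ts; apply/eqP => rts; apply: alone; exists t.
have mono := rotation_number_nondecreasing Hfam.
have iterE x : iter n (F s) x = x + p%:~R.
  have cx e : 0 < e -> exists2 d, 0 < d & forall t, t \in J -> `|t - s| < d ->
      `|iter n (F t) x - iter n (F s) x| < e.
    exact: ((within_continuous_distP _ _).1
      (family_iter_continuous Hfam (n := n) (x := x)) s sJ).
  have [xlt|xgt|//] := ltgtP (iter n (F s) x) (x + p%:~R).
    have [|d d0 Hd] := cx (x + p%:~R - iter n (F s) x); first by rewrite subr_gt0.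
    pose t := Num.min smax (s + d / 2).
    have [t1 t2 t3] : [/\ t <= smax, t <= s + d / 2 & s < t].
      by rewrite /t ge_min lexx ge_min lexx orbT lt_min; split=> //; lra.
    have tJ : t \in J by rewrite in_itv /=; lra.
    have rt : rho s < rho t.
      by rewrite lt_neqAle eq_sym neq// ?mono// ?gt_eqF// ltW.
    have ht : iter n (F t) x <= x + p%:~R.
      have : `|iter n (F t) x - iter n (F s) x| < x + p%:~R - iter n (F s) x.
        by apply: Hd => //; rewrite ltr_norml; lra.
      by rewrite ltr_norml; lra.
    have := rotation_number_le (family_degree1 Hfam tJ) ht.
    by rewrite -np ler_pM2l// leNgt rt.
  have [|d d0 Hd] := cx (iter n (F s) x - (x + p%:~R)); first by rewrite subr_gt0.
  pose t := Num.max smin (s - d / 2).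
  have [t1 t2 t3] : [/\ smin <= t, s - d / 2 <= t & t < s].
    by rewrite /t le_max lexx le_max lexx orbT gt_max; split=> //; lra.
  have tJ : t \in J by rewrite in_itv /=; lra.
  have rt : rho t < rho s.
    by rewrite lt_neqAle neq// ?mono// ?lt_eqF// ltW.
  have ht : x + p%:~R <= iter n (F t) x.
    have : `|iter n (F t) x - iter n (F s) x| < iter n (F s) x - (x + p%:~R).
      by apply: Hd => //; rewrite ltr_norml; lra.
    by rewrite ltr_norml; lra.
  have := rotation_number_ge (family_degree1 Hfam tJ) ht.
  by rewrite -np ler_pM2l// leNgt rt.
pose j := Ordinal (mf_flat_pos Hfam).
have /andP[ab _] := mf_flat_arc Hfam sJ j.
have := family_flat Hfam j 0 sJ; rewrite !addr0 => Fab.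
have := iterE (b j s); have := iterE (a j s).
rewrite -(prednK n0) !iterSr Fab => -> /addIr abE.
by move: ab; rewrite abE ltxx.
Qed.

End RationalPlateaus.

(** Positive length of a plateau can fail only where an end of the parameter interval cuts it off.
    Perfectness is asserted for [closure C], together with the fact that the added points are ends
    of plateaus. Steepness concerns ends with parameters beyond them. *)
Theorem theorem1p3 (R : realType) (smin smax : R)
    (f : R -> circle R -> circle R) (F : R -> R -> R)
    (m : nat) (a b : 'I_m -> R -> R)
    (Hfam : monotone_family smin smax f F a b) :
  let rho := fun s : R => rotation_number (F s) in
  let C := irrational_params smin smax rho in
  ((forall s, s \in `[smin, smax] -> forall x : R,
      (iter n (F s) x - x) / n%:R @[n --> \oo] --> rho s) /\
   {within `[smin, smax], continuous rho} /\
   {in `[smin, smax] &, {homo rho : s t / s <= t}}) /\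
  ((forall r : rat, plateau smin smax rho r !=set0 ->
      exists al be : R,
        [/\ plateau smin smax rho r = [set` `[al, be]], al <= be &
            al = be -> al = smin \/ al = smax]) /\
   (forall r : R, irrational r -> level_set smin smax rho r !=set0 ->
      exists s : R, level_set smin smax rho r = [set s])) /\
  (nowhere_dense C /\ perfect_set (closure C) /\
   (forall s, closure C s -> ~ C s -> exists r : rat,
      left_endpoint (plateau smin smax rho r) s \/
      right_endpoint (plateau smin smax rho r) s)) /\
  hausdorff_dim C = 0%E /\
  (forall (r : rat) (s0 : R),
    (right_endpoint (plateau smin smax rho r) s0 -> s0 < smax ->
      (exists c delta : R, [/\ 0 < c, 0 < delta &
         forall ds : R, 0 < ds < delta -> s0 + ds <= smax ->
           ds < expR (- (c / (rho (s0 + ds) - rho s0)))]) /\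
      (forall n : nat,
         (fun ds : R => ds) =o_ (0^'+)
         (fun ds : R => (rho (s0 + ds) - rho s0) ^+ n))) /\
    (left_endpoint (plateau smin smax rho r) s0 -> smin < s0 ->
      (exists c delta : R, [/\ 0 < c, 0 < delta &
         forall ds : R, 0 < ds < delta -> smin <= s0 - ds ->
           ds < expR (- (c / (rho s0 - rho (s0 - ds))))]) /\
      (forall n : nat,
         (fun ds : R => ds) =o_ (0^'+)
         (fun ds : R => (rho s0 - rho (s0 - ds)) ^+ n)))).
Proof.
move=> rho C.
have ltsmin := mf_params Hfam.
have mono := rotation_number_nondecreasing Hfam.
have cont := rotation_number_continuous Hfam.
have between := rational_between_family Hfam.
have plat := rational_param_not_alone Hfam.
have ratR (r : rat) : rational (ratr r : R) by exists r.
have flat_endpoint (r : rat) s0 : plateau smin smax rho r s0 -> rational (rho s0).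
  by move=> [_ ->].
split; [split; [|by split]|split; [split|split; [split; [|split]|split]]].
- by move=> s sJ x; exact: (@rotation_number_cvg _ (F s) x (family_degree1 Hfam sJ)).
- by move=> r /(rational_level_set_itv mono cont plat (ratR r)).
- by move=> r ir /(irrational_level_set_point mono between ir).
- exact: irrational_params_nowhere_dense mono cont between plat.
- exact: closure_irrational_params_perfect ltsmin mono cont between.
- by move=> s /(closure_irrational_params_endpoint mono cont plat).
- have [c [K [B [c0 K0 B0 H]]]] := irrational_params_cover ltsmin mono between.
  exact: hausdorff_dim_small_covers c0 K0 B0 H.
move=> r s0; split=> [[Ps ub] s0max|[Ps lb] s0min]; have [s0J rs0] := Ps.
  have [|[c [d [c0 d0 H]]] o] := steep_right mono between s0J s0max (flat_endpoint _ _ Ps).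
    move=> t tJ st; apply/eqP => rt; have : t <= s0 by apply: ub; split=> //; rewrite -rs0.
    by rewrite leNgt st.
  by split=> //; exists c, d; split=> // ds dsd _; exact: H.
have [|[c [d [c0 d0 H]]] o] := steep_left mono between s0J s0min (flat_endpoint _ _ Ps).
  move=> t tJ st; apply/eqP => rt; have : s0 <= t by apply: lb; split=> //; rewrite -rs0.
  by rewrite leNgt st.
by split=> //; exists c, d; split=> // ds dsd _; exact: H.
Qed.
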